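(* Let $d \geq 4$ be an even integer and $n\ge 1$ an integer. Let $q$ be a power of an odd prime $p$ such that $q^n \equiv 1 \pmod{2d}$ and $q>\frac{(n-1)^2d^4}{\pi^2(d-1)^2}$. If the subfield $\mathbb{F}_q\subseteq \mathbb{F}_{q^n}$ is a maximal subfield clique in the generalized Peisert graph $GP^*(q^n,d)$, then $\mathbb{F}_q$ is also a maximal clique in $GP^*(q^n,d)$.
   Context: For an abelian group $G$ and $S \subset G\setminus\{0\}$ with $S=-S$, the Cayley graph $\operatorname{Cay}(G,S)$ has vertex set $G$, with $g,h$ adjacent iff $g-h\in S$. For a positive even integer $d$ and a prime power $Q\equiv 1 \pmod{2d}$, the $d$-th power Peisert graph $GP^*(Q,d)$ is $\operatorname{Cay}(\mathbb{F}_Q^+, M_{Q,d})$, where $\mathbb{F}_Q^+$ is the additive group of $\mathbb{F}_Q$, $M_{Q,d}=\{g^{dk+j}: 0\le j\le \frac d2-1,\ k\in\mathbb{Z}\}$, and $g$ is a fixed primitive root of $\mathbb{F}_Q$ (the isomorphism class does not depend on the choice of $g$). A clique is a set of pairwise adjacent vertices; a maximal clique is a clique not contained in a strictly larger clique. For a Cayley graph on $\mathbb{F}_{Q}^+$, a subfield clique is a clique that is a subfield of $\mathbb{F}_Q$, and a maximal subfield clique is a subfield clique not contained in a strictly larger subfield clique. *)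

(* Defs.v *)
From HB Require Import structures.
From mathcomp Require Import all_boot all_order all_algebra.
From mathcomp Require Import boolp reals trigo.
Set Implicit Arguments.
Unset Strict Implicit.
Unset Printing Implicit Defensive.
Import Order.TTheory GRing.Theory Num.Theory.
Local Open Scope ring_scope.

Definition cayley (G : finZmodType) (S : {set G}) : rel G :=
  fun x y => x - y \in S.

Definition is_clique (T : finType) (e : rel T) (C : {set T}) : Prop :=
  {in C &, forall x y, x != y -> e x y}.

Definition is_maximal_clique (T : finType) (e : rel T) (C : {set T}) : Prop :=
  is_clique e C /\ ~ exists D : {set T}, is_clique e D /\ C \proper D.

Definition is_subfield (F : finFieldType) (K : {set F}) : Prop :=
  divring_closed K.

Definition is_subfield_clique (F : finFieldType) (e : rel F) (K : {set F}) :
  Prop := is_subfield K /\ is_clique e K.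

Definition is_maximal_subfield_clique (F : finFieldType) (e : rel F)
    (K : {set F}) : Prop :=
  is_subfield_clique e K /\
  ~ exists L : {set F}, is_subfield_clique e L /\ K \proper L.

Definition is_primitive_root (F : finFieldType) (g : F) : Prop :=
  (#|F|.-1).-primitive_root g.

Lemma primitive_root_neq0 (F : finFieldType) (g : F) :
  is_primitive_root g -> g != 0.
Proof.
move=> gP; apply/eqP => g0; have /eqP := prim_expr_order gP.
by rewrite g0 expr0n gtn_eqF ?(prim_order_gt0 gP)// eq_sym oner_eq0.
Qed.

Definition peisert_set (F : finFieldType) (g : F) (d : nat) : {set F} :=
  finset (fun x : F => `[< exists (k : int) (j : nat),
    (j <= d./2 - 1)%N /\ x = g ^ (d%:Z * k + j%:Z) >]).

Definition peisert_graph (F : finFieldType) (g : F) (d : nat) : rel F :=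
  cayley (peisert_set g d).

(* The connection set avoids 0 and is symmetric, so that the relation above is
   a simple graph. *)
Lemma peisert_set0 (F : finFieldType) (g : F) (d : nat) :
  is_primitive_root g -> 0 \notin peisert_set g d.
Proof.
move=> gP; rewrite inE; apply/asboolP => -[k [j [_ /esym/eqP]]].
have g0 : g != 0 := primitive_root_neq0 gP.
by rewrite expfz_eq0 (negPf g0) andbF.
Qed.

Lemma peisert_setN (F : finFieldType) (g : F) (d : nat) :
  (0 < d)%N -> #|F| = 1 %[mod 2 * d] -> is_primitive_root g ->
  forall x, x \in peisert_set g d -> - x \in peisert_set g d.
Proof.
move=> d0 Fd gP x; rewrite !inE => /asboolP[k [j [jd ->]]].
have g0 : g != 0 := primitive_root_neq0 gP.
have F1 : (1 < #|F|)%N := card_finNzRing_gt1 F.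
have /dvdnP[m Em] : (2 * d %| #|F|.-1)%N.
  by rewrite -subn1 -eqn_mod_dvd ?(ltnW F1)//; apply/eqP.
have gm : g ^+ (d * m) = -1.
  have m0 : (0 < d * m)%N.
    by have := prim_order_gt0 gP; rewrite Em !muln_gt0 d0; case: m {Em}.
  have Em2 : (#|F|.-1 = d * m * 2)%N by rewrite Em mulnC -mulnA mulnC.
  have /eqP : (g ^+ (d * m)) ^+ 2 = 1.
    by rewrite -exprM -Em2 (prim_expr_order gP).
  rewrite sqrf_eq1 => /orP[|/eqP//].
  rewrite -(prim_order_dvd gP) Em2 => /(dvdn_leq m0).
  by rewrite leqNgt ltn_Pmulr.
apply/asboolP; exists (k + m%:Z), j; split => //.
rewrite mulrDr addrAC [in RHS]expfzDr//.
by rewrite -PoszM -exprnP gm mulrN1.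
Qed.

(* Main.v *)
Require Import Defs.
From HB Require Import structures.
From mathcomp Require Import all_boot all_order all_algebra.
From mathcomp Require Import boolp reals trigo.
From mathcomp Require Import functions topology normedtype derive.
From mathcomp Require Import qpoly qfpoly finfield separable galois complex.
From mathcomp Require Import zify ring lra.
Set Implicit Arguments.
Unset Strict Implicit.
Unset Printing Implicit Defensive.
Import Order.TTheory GRing.Theory Num.Theory.
Import numFieldNormedType.Exports.
Local Open Scope ring_scope.

(* A clique properly containing [Fq] contains some [v] outside [Fq] such that
   [v + a] lies in the connection set for all [a] in [Fq]. Let [chi] be the
   character of order [d] with [chi g = exp (2 i pi / d)]: the values
   [chi (v + a)] all lie on an arc of less than a half circle, hence
   [|sum_a chi (v + a)| >= q sin (pi / d)]. Since [Fq] is a clique, [chi] is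
   trivial on its nonzero elements; since it is a maximal subfield clique, [chi]
   is not trivial on [Fq(v)], of degree [m <= n] over [Fq]. Katz's bound
   [|sum_a chi (v + a)| <= (m - 1) sqrt q] then contradicts the size of [q].

   To prove Katz's bound, let [c_n] be the sum of [chi (P v)] over the monic
   polynomials [P] of degree [n] over [Fq]. Then [c_n = 0] for [n >= m], so that
   [sum_n c_n T^n] is a polynomial [prod (1 - w_i T)] with at most [m - 1]
   factors, and unique factorization expresses the power sums of the [w_i]
   through the values of [chi] on prime powers, that is, as Kummer character
   sums over the extensions of [Fq]. Stepanov's method, in Bombieri's form,
   bounds these sums by [O(sqrt #|E|)] over the extension [E], and this forces
   [|w_i| <= sqrt q]. *)

(** * Stepanov's method *)

Lemma exprBn_pchar (R : comNzRingType) (x y : R) n :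
  [pchar R].-nat n -> (x - y) ^+ n = x ^+ n - y ^+ n.
Proof.
by move=> nn; apply/eqP; rewrite eq_sym subr_eq -exprDn_pchar // subrK.
Qed.

Lemma expr_sum_pchar (R : comNzRingType) (I : finType) (G : I -> R) n :
  [pchar R].-nat n -> (\sum_i G i) ^+ n = \sum_i G i ^+ n.
Proof.
move=> nn; have n0 : (0 < n)%N by case/andP: nn.
apply: (big_morph (fun x => x ^+ n)) => [x y|]; first exact: exprDn_pchar.
by rewrite expr0n gtn_eqF.
Qed.

(** The leading coefficient of a nonzero summand of largest size survives in the sum. *)
Lemma sum_distinct_size_eq0 (R : nzRingType) (I : finType) (G : I -> {poly R}) :
  (forall i j, G i != 0 -> size (G i) = size (G j) -> i = j) ->
  \sum_i G i = 0 -> forall i, G i = 0.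
Proof.
move=> dist sum0 i0; apply/eqP/negPn/negP => Gi0.
have [i _ imax] := @arg_maxnP _ i0 xpredT (fun i => size (G i)) isT.
have Gi : G i != 0.
  by rewrite -size_poly_gt0 (leq_trans _ (imax i0 isT)) // size_poly_gt0.
have /(congr1 (fun p : {poly R} => p`_(size (G i)).-1)) := sum0.
rewrite coef0 coef_sum (bigD1 i) //= big1 ?addr0.
  by move/eqP; rewrite -lead_coefE lead_coef_eq0 (negPf Gi).
move=> j ji; rewrite nth_default // -ltnS prednK ?size_poly_gt0 //.
rewrite ltn_neqAle [X in _ && X](imax j isT) andbT; apply/eqP => eqs.
by move/eqP: ji; apply; apply/esym/(dist _ _ Gi).
Qed.

(* The relevant curve is [y ^ D = f x], with one point at infinity. As [w] is a power of the
   characteristic, [stepanov_poly x ^ w] and [stepanov_cond x] agree, up to a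
   nonzero factor, at every [u] with [f(u) ^ ((w^2 - 1) / D) = z]. *)
Section Stepanov.
Variables (E : finFieldType) (w D t B : nat) (f : {poly E}) (z : E).
Hypotheses (w_nat : [pchar E].-nat w) (card_E : #|E| = (w ^ 2)%N).
Hypotheses (D_gt1 : (1 < D)%N) (wE : w = (D * t).+1).
Hypotheses (size_f : size f = B.+1) (coBD : coprime B D).
Hypothesis t_large : (2 * B + 4 <= t)%N.

(** [A] bounds the size of the unknown coefficients and is small enough for [D * A + D * B < w];
    [J], the number of powers of ['X^w], makes the [A * (D * J)] unknowns outnumber the [L]
    coefficients of [stepanov_cond]. *)
Let A := (t - B)%N.
Let J := (t + 2 * B + 2)%N.
Let L := (w * A + B * w + J)%N.
Let T := {ffun 'I_D * 'I_J -> 'rV[E]_A}.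

Let stepanov_poly (x : T) : {poly E} :=
  \sum_(ij : 'I_D * 'I_J) rVpoly (x ij) * f ^+ (ij.1 * t) * 'X^(ij.2 * w).
Let stepanov_cond (x : T) : {poly E} :=
  \sum_(ij : 'I_D * 'I_J) z ^+ ij.1 *: (rVpoly (x ij) ^+ w *
    f ^+ ((D - ij.1) * t) * 'X^(ij.2)).

Let f_neq0 : f != 0. Proof. by rewrite -size_poly_eq0 size_f. Qed.

Let sizeX_f n : size (f ^+ n) = (B * n).+1.
Proof.
rewrite -[LHS]prednK ?size_poly_gt0 ?expf_neq0 //.
by rewrite size_exp size_f.
Qed.

Let wpoly_nat : [pchar {poly E}].-nat w.
Proof. by rewrite (eq_pnat _ (@pchar_poly E)). Qed.

Let stepanov_condB (x y : T) :
  stepanov_cond (x - y) = stepanov_cond x - stepanov_cond y.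
Proof.
rewrite /stepanov_cond -sumrB; apply: eq_bigr => ij _.
by rewrite !ffunE linearB /= exprBn_pchar // -scalerBr !mulrBl.
Qed.

Let size_stepanov_cond (x : T) : (size (stepanov_cond x) <= L)%N.
Proof.
apply: (leq_trans (size_sum _ _ _)); apply/bigmax_leqP => -[i j] _ /=.
apply: (leq_trans (size_scale_leq _ _)).
apply: (leq_trans (size_polyMleq _ _)); rewrite size_polyXn.
have := size_polyMleq (rVpoly (x (i, j)) ^+ w) (f ^+ ((D - i) * t)).
rewrite sizeX_f; have := size_poly_exp_leq (rVpoly (x (i, j))) w.
have sx : (size (rVpoly (x (i, j))) <= A)%N by exact: size_poly.
have A0 : (0 < A)%N by rewrite /A; lia.
have : (((size (rVpoly (x (i, j)))).-1 * w) <= A.-1 * w)%N by rewrite leq_mul2r; lia.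
have : (B * ((D - i) * t) <= B * (D * t))%N by rewrite !leq_mul ?leq_subr.
have := ltn_ord j; rewrite /L.
have : (A.-1 * w + w = w * A)%N by rewrite -mulSnr prednK // mulnC.
have : (B * (D * t) + B = B * w)%N by rewrite wE mulnS addnC.
set a := (A.-1 * w)%N; set b := (B * (D * t))%N.
set c := (w * A)%N; set e := (B * w)%N; set g := (B * _)%N; set h := (_ * w)%N.
set s1 := size (polyseq (_ * _)); set s2 := size (polyseq (_ ^+ w)).
by clearbody a b c e g h s1 s2; move: (nat_of_ord j) => j'; lia.
Qed.

(** As [D * t = w - 1], [D] times the size of a nonzero term is
    [D * a + (i * B + j * D) * w - i * B], with [a] the size of its unknown coefficient. Since
    [D * A + D * B < w], this determines [i * B + j * D], then [i] because [B] and [D] are coprime,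
    then [j]. Hence no two terms have the same size. *)
Let stepanov_poly_eq0 (x : T) : stepanov_poly x = 0 -> x = 0.
Proof.
move=> x0; have sz ij : rVpoly (x ij) != 0 -> size (rVpoly (x ij) *
    f ^+ (ij.1 * t) * 'X^(ij.2 * w)) =
    (size (rVpoly (x ij)) + B * (ij.1 * t) + ij.2 * w)%N.
  move=> xij; rewrite !size_mul ?mulf_neq0 ?expf_neq0 ?polyX_eq0 //.
  by rewrite size_polyXn sizeX_f !addnS.
have Gn0 ij : (rVpoly (x ij) * f ^+ (ij.1 * t) * 'X^(ij.2 * w) == 0) =
    (rVpoly (x ij) == 0).
  by rewrite !mulf_eq0 !expf_eq0 (negPf f_neq0) polyX_eq0 !andbF !orbF.
apply/ffunP => ij; rewrite !ffunE; apply: (can_inj (@rVpolyK _ _)).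
rewrite linear0; apply/eqP; rewrite -Gn0.
apply/eqP; move: ij; apply: sum_distinct_size_eq0 x0 => ij ij' Gij.
move=> eqs; have Gij' : rVpoly (x ij') != 0.
  by rewrite -Gn0 -size_poly_gt0 -eqs size_poly_gt0.
rewrite Gn0 in Gij.
move: eqs; rewrite !sz //; move: Gij Gij'; rewrite -!size_poly_gt0.
case: ij ij' => [i j] [i' j'] /=.
have : (size (rVpoly (x (i, j))) <= A)%N by exact: size_poly.
have : (size (rVpoly (x (i', j'))) <= A)%N by exact: size_poly.
set a' := size _; set a := size _ => la' la a0 a0' /(congr1 (muln D)).
have key (u v y : nat) : (D * (y + B * (u * t) + v * w) + u * B =
    D * y + (u * B + v * D) * w)%N by rewrite wE; lia.
move=> eqD; have {eqD} : (D * a + (i * B + j * D) * w + i' * B =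
    D * a' + (i' * B + j' * D) * w + i * B)%N.
  by rewrite -!key eqD; lia.
set n := (i * B + j * D)%N; set n' := (i' * B + j' * D)%N.
have wA : (D * A + D * B < w)%N by rewrite wE /A -mulnDr subnK ?ltnSn //; lia.
have far n1 n2 i1 i2 a1 a2 : (i1 < D)%N -> (0 < a2)%N -> (a1 <= A)%N ->
    (D * a1 + n1 * w + i1 * B = D * a2 + n2 * w + i2 * B)%N -> (n2 <= n1)%N.
  move=> li a20 la1 eq12; rewrite leqNgt; apply/negP => lt12.
  have : (n1.+1 * w <= n2 * w)%N by rewrite leq_mul2r lt12 orbT.
  have : (i1 * B <= D * B)%N by rewrite leq_mul2r ltnW ?orbT.
  have : (D * a1 <= D * A)%N by rewrite leq_mul2l la1 orbT.
  by rewrite mulSn; lia.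
move=> eqaa; have {eqaa} eqaa : (D * a + n * w + i' * B = D * a' + n' * w + i * B)%N by [].
have eqn : n = n'.
  by apply/eqP; rewrite eqn_leq (far _ _ _ _ _ _ (ltn_ord i') a0' la eqaa)
     (far _ _ _ _ _ _ (ltn_ord i) a0 la' (esym eqaa)).
have le_i i1 i2 j1 j2 : (i1 < D)%N -> (i1 * B + j1 * D = i2 * B + j2 * D)%N ->
    (i1 <= i2)%N.
  move=> li1 eq12; rewrite leqNgt; apply/negP => lt21.
  have : (D %| (i1 - i2) * B)%N.
    rewrite mulnBl -(dvdn_addr (m := (j1 * D)%N)) ?dvdn_mull //.
    rewrite addnBA ?leq_mul2r ?(ltnW lt21) ?orbT // addnC eq12 addKn.
    exact: dvdn_mull.
  rewrite Gauss_dvdl ?(coprime_sym D) // => /dvdn_leq; rewrite subn_gt0 lt21.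
  by move/(_ isT); lia.
have eqi : i = i'.
  apply/val_inj/eqP; rewrite /= eqn_leq (le_i _ _ _ _ (ltn_ord i) eqn).
  exact: (le_i _ _ _ _ (ltn_ord i') (esym eqn)).
congr (_, _) => //; apply/val_inj/eqP => /=.
move: eqn; rewrite /n /n' eqi => /addnI/eqP.
by rewrite eqn_pmul2r ?(ltnW D_gt1).
Qed.

Let stepanov_count : (w * A + B * w + J < A * (D * J))%N.
Proof.
(* In terms of [D - 2] and [t - (2 * B + 4)], the difference of the two sides is a polynomial with
   nonnegative coefficients. *)
have [y Dy] : exists y, D = (y + 2)%N by exists (D - 2)%N; lia.
have [x tx] : exists x, t = (x + 2 * B + 4)%N by exists (t - (2 * B + 4))%N; lia.
rewrite /A /J wE Dy tx (_ : x + 2 * B + 4 - B = x + B + 4)%N; last lia.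
set l := (X in (X < _)%N); set r := (X in (_ < X)%N).
have -> : (r = (l + (B * x * y + 6 * B * y + 2 * B * x + 6 * B + 2 * x * y +
  8 * y + 2 * x + 5)).+1)%N by rewrite /l /r; lia.
by rewrite ltnS leq_addr.
Qed.

(** Because of the power [w], [stepanov_cond] is additive but only semilinear over [E]; a kernel
    element comes from the pigeonhole principle. *)
Let stepanov_solution : exists2 x : T, x != 0 & stepanov_cond x = 0.
Proof.
pose h (x : T) : 'rV[E]_L := poly_rV (stepanov_cond x).
have [inj|ninj] := boolP (injectiveb h).
  have := leq_card h (injectiveP _ inj).
  rewrite card_ffun card_prod !card_ord !card_mx !mul1n -expnM leqNgt.
  by case/negP; rewrite ltn_exp2l ?card_finNzRing_gt1.
have [x [y xy hxy]] := injectivePn _ ninj.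
exists (x - y); first by rewrite subr_eq0.
rewrite stepanov_condB; apply/eqP; rewrite subr_eq0; apply/eqP.
by rewrite -(poly_rV_K (size_stepanov_cond x)) -[poly_rV _]/(h x) hxy poly_rV_K.
Qed.

Let stepanov_root (x : T) u : stepanov_cond x = 0 -> f.[u] != 0 ->
  f.[u] ^+ (t * w.+1) = z -> root (stepanov_poly x) u.
Proof.
move=> x0 fu fuz; have uw2 v : (v ^+ w) ^+ w = v :> E.
  by rewrite -exprM -[(w * w)%N]/(w ^ 2)%N -card_E expf_card.
(* The factor [f.[u] ^+ (D * t)] clears the denominator in [f.[u] ^+ (i * t * w) = z ^+ i / f.[u] ^+
   (i * t)]. *)
rewrite rootE; suff : (stepanov_poly x).[u] ^+ w * f.[u] ^+ (D * t) == 0.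
  by rewrite mulf_eq0 !expf_eq0 (negPf fu) andbF orbF => /andP[].
move/(congr1 (fun p => p.[u])): x0; rewrite horner0 => <-.
rewrite !horner_sum expr_sum_pchar // mulr_suml; apply/eqP/eq_bigr => -[i j] _.
rewrite !hornerE !exprMn -!exprM /= -fuz.
have -> : u ^+ (j * w * w) = u ^+ j by rewrite !exprM uw2.
have e : f.[u] ^+ (i * t * w) * f.[u] ^+ (D * t) =
    (f.[u] ^+ (t * w.+1)) ^+ i * f.[u] ^+ ((D - i) * t).
  rewrite -exprM -!exprD mulnBl mulnS; congr (_ ^+ _).
  have : (i * t <= D * t)%N by rewrite leq_mul // ltnW.
  by move: (nat_of_ord i) => i'; lia.
by rewrite mulrAC -[_ * _ * f.[u] ^+ (D * t)]mulrA e; ring.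
Qed.

Lemma stepanov_bound :
  (D * #|[set u | (f.[u] != 0)%R & f.[u] ^+ (t * w.+1) == z]| <=
   w ^ 2 + (1 + D * B + D * (2 * B + 2)) * w)%N.
Proof.
have [x x0 xc] := stepanov_solution.
have px : stepanov_poly x != 0.
  by apply: contra x0 => /eqP/stepanov_poly_eq0 ->.
set S := [set u | _ & _].
have H : (#|S| < size (stepanov_poly x))%N.
  rewrite cardE; apply: max_poly_roots px _ (enum_uniq _).
  apply/allP => u; rewrite mem_enum inE => /andP[fu /eqP fz].
  exact: stepanov_root.
have sz : (size (stepanov_poly x) <= A + B * (D * t) + J.-1 * w)%N.
  apply: (leq_trans (size_sum _ _ _)); apply/bigmax_leqP => -[i j] _ /=.
  apply: (leq_trans (size_polyMleq _ _)); rewrite size_polyXn.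
  have := size_polyMleq (rVpoly (x (i, j))) (f ^+ (i * t)).
  rewrite sizeX_f.
  have : (size (rVpoly (x (i, j))) <= A)%N by exact: size_poly.
  have : (B * (i * t) <= B * (D * t))%N by rewrite !leq_mul // ltnW.
  have : (j * w <= J.-1 * w)%N by rewrite leq_mul // -ltnS prednK ?ltn_ord // /J addn2.
  have : (0 < A)%N by rewrite /A; lia.
  set a := (B * _)%N; set b := (B * _)%N; set c := (j * w)%N; set e := (_ * w)%N.
  set s1 := size (polyseq (_ * _)); set s2 := size (polyseq (rVpoly _)).
  by clearbody a b c e s1 s2; lia.
have {sz} := leq_trans H sz; set N := #|_| => {H} H.
have : (D * N <= D * (A + B * (D * t) + J.-1 * w))%N by rewrite leq_mul2l ltnW ?orbT.
have -> : (D * (A + B * (D * t) + J.-1 * w) =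
   D * A + D * B * (D * t) + (D * t * w + D * (2 * B + 1) * w))%N.
  by rewrite /J addn2 /=; lia.
have : (D * A <= w)%N by rewrite wE ltnW // ltnS leq_mul // leq_subr.
have : (D * B * (D * t) <= D * B * w)%N by rewrite leq_mul // wE.
have : (D * t * w <= w ^ 2)%N by rewrite expnS expn1 leq_mul // wE.
set a := (D * t * w)%N; lia.
Qed.

End Stepanov.

(** * Subfields and extensions of finite fields *)

Section SubfieldType.
Variables (F : finFieldType) (S : {set F}) (S_subfield : divring_closed S).

Let Spred : {pred F} := mem S.
HB.instance Definition _ := GRing.isDivringClosed.Build F Spred S_subfield.

Record subfield_type := SubfieldElt { subfield_val : F; _ : subfield_val \in Spred }.
HB.instance Definition _ := [isSub for subfield_val].
HB.instance Definition _ := [Finite of subfield_type by <:].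
HB.instance Definition _ := [SubChoice_isSubIntegralDomain of subfield_type by <:].
HB.instance Definition _ := [SubIntegralDomain_isSubField of subfield_type by <:].

(** Passes from the subfields of the theorem, which are sets, to field types linked by morphisms, on
    which polynomials and characters are handled. *)
Lemma subfield_typeP : exists (K : finFieldType) (i : {rmorphism K -> F}),
  S =i codom i /\ #|K| = #|S|.
Proof.
exists subfield_type; exists (val : {rmorphism subfield_type -> F}).
split; last by rewrite card_sub; apply: eq_card.
move=> x; apply/idP/codomP => [xS|[y ->]]; last exact: (valP y).
by exists (SubfieldElt xS).
Qed.

End SubfieldType.

Lemma frobenius_fixed_subfield (F : finFieldType) Q :
  [pchar F].-nat Q -> divring_closed [set x : F | x ^+ Q == x].
Proof.
move=> QF; split=> [|x y|x y]; rewrite !inE ?expr1n ?eqxx //.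
  by move=> /eqP xQ /eqP yQ; rewrite exprBn_pchar // xQ yQ.
by move=> /eqP xQ /eqP yQ; rewrite exprMn exprVn xQ yQ.
Qed.

Lemma pchar_nat_card (F : finFieldType) : [pchar F].-nat #|F|.
Proof.
have [p p_pr pF] := finPcharP F.
rewrite (eq_pnat _ (pcharf_eq pF)).
have -> : #|F| = (p ^ logn p #|F|)%N := card_pprimeChar pF.
by rewrite pnatX pnat_id.
Qed.

Lemma pchar_nat_rmorph (K L : fieldType) (i : {rmorphism K -> L}) n :
  [pchar K].-nat n -> [pchar L].-nat n.
Proof.
by rewrite (eq_pnat _ (fmorph_pchar i)).
Qed.

Lemma rmorphism_factor (K E L : fieldType) (i : {rmorphism E -> L})
    (h : {rmorphism K -> L}) : (forall x, exists y, i y = h x) ->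
  exists j : {rmorphism K -> E}, forall x, i (j x) = h x.
Proof.
move=> /boolp.choice[j ij].
have jB : zmod_morphism j.
  by move=> x y; apply: (fmorph_inj i); rewrite rmorphB /= !ij rmorphB.
have jM : monoid_morphism j.
  split=> [|x y]; apply: (fmorph_inj i); rewrite ?rmorphM !ij ?rmorphM ?rmorph1 //.
pose jm := GRing.isZmodMorphism.Build K E j jB.
pose jn := GRing.isMonoidMorphism.Build K E j jM.
pose j' : {rmorphism K -> E} := HB.pack j jm jn.
by exists j'.
Qed.

Lemma expf_cardX (K : finFieldType) (x : K) n : x ^+ (#|K| ^ n) = x.
Proof. by elim: n => [|n IH]; rewrite ?expr1 // expnSr exprM IH expf_card. Qed.

(** [E] consists of the roots of ['X^Q - 'X] in a splitting field; they are simple because the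
    derivative is [-1], so there are [Q] of them. *)
Lemma finite_extension (K : finFieldType) N : (0 < N)%N ->
  exists (E : finFieldType) (i : {rmorphism K -> E}), #|E| = (#|K| ^ N)%N.
Proof.
move=> N0; set Q := (#|K| ^ N)%N.
have Q1 : (1 < Q)%N by rewrite -[1%N](expn0 #|K|) ltn_exp2l // card_finNzRing_gt1.
pose q (R : nzRingType) : {poly R} := 'X^Q - 'X.
have sq (R : nzRingType) : size (q R) = Q.+1.
  by rewrite /q size_polyDl size_polyXn // size_polyN size_polyX.
have /FinSplittingFieldFor[/= L [zs Dq _]] : q K != 0 by rewrite -size_poly_eq0 sq.
rewrite [map_poly _ _]rmorphB rmorphXn /= map_polyX -/(q L) in Dq.
pose L' : finFieldType := FinFieldExtType L.
pose iL : {rmorphism K -> L'} := in_alg L.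
have QL : [pchar L'].-nat Q.
  by apply: (pchar_nat_rmorph iL); rewrite pnatX pchar_nat_card.
have Uzs : uniq zs.
  rewrite -separable_prod_XsubC -(eqp_separable Dq) unlock.
  rewrite derivB derivXn derivX.
  have -> : 'X^(Q.-1) *+ Q = 0 :> {poly L}.
    have [p p_pr pL] := finPcharP L'; rewrite -mulr_natr -polyC_natr.
    have := QL; rewrite (eq_pnat _ (pcharf_eq pL)) => /p_natP[e Qe].
    have e0 : (0 < e)%N by case: e Qe Q1 => // ->.
    by rewrite Qe natrX (pcharf0 pL) expr0n gtn_eqF // mulr0.
  by rewrite sub0r -scaleN1r coprimepZr ?coprimep1 // oppr_eq0 oner_neq0.
have [E [i [Si cE]]] := subfield_typeP (frobenius_fixed_subfield QL).
have [|j _] := @rmorphism_factor K E L' i iL.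
  move=> x; have : iL x \in [set x : L' | x ^+ Q == x].
    by rewrite inE -rmorphXn expf_cardX.
  by rewrite Si => /codomP[y ->]; exists y.
exists E, j; rewrite cE.
have /eq_card-> : [set x : L' | x ^+ Q == x] =i zs.
  move=> x; rewrite -root_prod_XsubC -(eqp_root Dq) inE /root /q !hornerE.
  by rewrite subr_eq0.
rewrite (card_uniqP (Uzs : @uniq L' zs)); apply: succn_inj.
by rewrite -(size_prod_XsubC _ id) -(eqp_size Dq) sq.
Qed.

(** * Monic polynomials and the Euler product *)

Lemma irreducible_factor (K : fieldType) (g : {poly K}) : (1 < size g)%N ->
  exists P, [/\ P \is monic, irreducible_poly P & P %| g].
Proof.
have [n] := ubnP (size g); elim: n g => // n IH g; rewrite ltnS => gn g1.
have g0 : g != 0 by rewrite -size_poly_gt0 ltnW.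
have [irr|nirr] := boolp.EM (irreducible_poly g).
  exists ((lead_coef g)^-1 *: g); have lg : (lead_coef g)^-1 != 0.
    by rewrite invr_eq0 lead_coef_eq0.
  split; first by rewrite monicE lead_coefZ mulVf // lead_coef_eq0.
    split=> [|q q1]; first by rewrite size_scale.
    rewrite dvdpZr // => qg; rewrite (eqp_trans (irr.2 _ q1 qg)) //.
    by rewrite eqp_sym eqp_scale.
  by rewrite dvdpZl.
have [q [q1 qg nqg]] : exists q : {poly K},
    [/\ size q != 1, q %| g & ~~ (q %= g)].
  apply: boolp.contrapT => H; apply: nirr; split=> // q q1 qg.
  by apply/negPn/negP => nq; apply: H; exists q.
have q0 : q != 0 by apply: dvdpN0 g0.
have sq : (size q < size g)%N.
  by rewrite ltn_neqAle dvdp_leq // andbT dvdp_size_eqp.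
have [|P [Pm Pi Pq]] := IH q (leq_trans sq gn).
  by rewrite ltn_neqAle eq_sym q1 size_poly_gt0.
by exists P; split=> //; apply: dvdp_trans qg.
Qed.

Section Monics.
Variable k : finFieldType.
Implicit Types (g P : {poly k}) (n e : nat).

(** Indexing by row vectors makes the lower coefficients range over an additive group, on which
    [sum_ev_monics] translates. *)
Definition monics n : seq {poly k} := codom (fun u : 'rV[k]_n => 'X^n + rVpoly u).

Lemma monics_uniq n : uniq (monics n).
Proof.
by rewrite map_inj_uniq ?enum_uniq // => u v /addrI; apply: (can_inj (@rVpolyK _ _)).
Qed.

Lemma mem_monics n g : (g \in monics n) = (g \is monic) && (size g == n.+1).
Proof.
have lt (u : 'rV[k]_n) : (size (rVpoly u) < size ('X^n : {poly k}))%N.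
  by rewrite size_polyXn ltnS size_poly.
apply/codomP/andP => [[u ->]|[gm /eqP gn]].
  by rewrite monicE lead_coefDl // lead_coefXn size_polyDl // size_polyXn.
exists (poly_rV (g - 'X^n)); rewrite poly_rV_K; first by rewrite addrC subrK.
apply/leq_sizeP => j; rewrite leq_eqVlt => /predU1P[<-|nj].
  rewrite coefB coefXn eqxx; move: gm; rewrite monicE lead_coefE gn => /eqP->.
  exact: subrr.
by rewrite coefB coefXn (gtn_eqF nj) subr0 nth_default // gn.
Qed.

Lemma monics0 : monics 0 = [:: 1].
Proof.
have : size (monics 0) = 1 by rewrite size_codom card_mx muln0.
have : 1 \in monics 0 by rewrite mem_monics monic1 size_poly1.
by case: (monics 0) => [|g []] //; rewrite inE => /eqP->.
Qed.

Definition irreds e := [seq P <- monics e | irreducibleb P].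

Lemma mem_irreds e P : (P \in irreds e) =
  [&& irreducibleb P, P \is monic & size P == e.+1].
Proof. by rewrite mem_filter mem_monics. Qed.

Lemma irreds_uniq e : uniq (irreds e).
Proof. exact/filter_uniq/monics_uniq. Qed.

Lemma perm_monics_mul n e P : P \in monics e ->
  (e <= n)%N ->
  perm_eq [seq g <- monics n | P %| g] [seq P * g | g <- monics (n - e)].
Proof.
rewrite mem_monics => /andP[Pm /eqP Pe] en.
have P0 : P != 0 by apply: monic_neq0.
apply: uniq_perm.
- exact/filter_uniq/monics_uniq.
- by rewrite map_inj_uniq ?monics_uniq //; apply: mulfI.
move=> g; rewrite mem_filter mem_monics; apply/andP/mapP => [[Pg /andP[gm gn]]|].
  exists (g %/ P); last by rewrite mulrC divpK.
  rewrite mem_monics -(monicMr _ Pm) divpK // gm size_divp // (eqP gn) Pe /=.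
  by apply/eqP; lia.
move=> [g' ]; rewrite mem_monics => /andP[g'm /eqP g'n] ->.
rewrite dvdp_mulr // monicMl // g'm size_mul ?monic_neq0 // Pe g'n; split=> //.
by apply/eqP; lia.
Qed.

Lemma monics_small n e P : P \in monics e -> (n < e)%N ->
  [seq g <- monics n | P %| g] = [::].
Proof.
rewrite mem_monics => /andP[Pm /eqP Pe] ne; apply/eqP.
rewrite -(negbK (_ == _)) -has_filter; apply/hasPn => g.
rewrite mem_monics => /andP[gm /eqP gn]; apply/negP => /dvdp_leq.
by rewrite monic_neq0 // Pe gn ltnS leqNgt ne => /(_ isT).
Qed.

Lemma monicsX e P j : P \in monics e -> P ^+ j \in monics (e * j).
Proof.
rewrite !mem_monics => /andP[Pm /eqP Pe]; rewrite monic_exp //=.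
by rewrite -[size _]prednK ?size_poly_gt0 ?expf_neq0 ?monic_neq0 // size_exp Pe.
Qed.

(** Dividing [g] by an irreducible factor [Q] lowers the multiplicity of [Q] by one and changes no
    other. The common bound [N] keeps the ranges of summation fixed along this induction. *)
Lemma degree_eq_sum_irreds n N g : (n <= N)%N -> g \in monics n ->
  (\sum_(1 <= e < N.+1) \sum_(P <- irreds e)
     \sum_(1 <= j < N.+1) (P ^+ j %| g)%R * e = n)%N.
Proof.
elim/ltn_ind: n g => -[|n] IH g nN gn.
  rewrite big1_seq // => e; rewrite mem_index_iota => /andP[_ /andP[e0 _]].
  rewrite big1_seq // => P /andP[_ Pe]; rewrite big1_seq // => j.
  rewrite mem_index_iota => /andP[_ /andP[j0 _]].
  move: Pe; rewrite mem_irreds => /and3P[_ Pm /eqP Pe].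
  have/monicsX Pj : P \in monics e by rewrite mem_monics Pm Pe /=.
  have /negbTE-> // : ~~ (P ^+ j %| g).
  apply: contraT; rewrite negbK => d.
  have : g \in [seq g <- monics 0 | P ^+ j %| g] by rewrite mem_filter d.
  by rewrite (monics_small (Pj j)) // muln_gt0 e0.
have := gn; rewrite mem_monics => /andP[gm /eqP gs].
have [|Q [Qm Qi Qg]] := @irreducible_factor _ g; first by rewrite gs.
pose e0 := (size Q).-1.
have sQ : size Q = e0.+1 by rewrite prednK // (leq_trans _ Qi.1).
have e0_gt0 : (0 < e0)%N by have := Qi.1; rewrite sQ.
have Qe : Q \in monics e0 by rewrite mem_monics Qm sQ /=.
have e0n : (e0 <= n.+1)%N.
  by rewrite -ltnS -sQ -gs dvdp_leq // monic_neq0.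
have : g \in [seq g <- monics n.+1 | Q %| g] by rewrite mem_filter Qg.
rewrite (perm_mem (perm_monics_mul Qe e0n)) => /mapP[h hn gQh].
have IHh := IH (n.+1 - e0)%N _ h _ hn.
rewrite -[RHS](subnK e0n) -IHh //; [|by lia..]; rewrite {IH IHh}.
have -> : e0 = (\sum_(1 <= e < N.+1) \sum_(P <- irreds e) (P == Q) * e)%N.
  rewrite (bigD1_seq e0) ?iota_uniq //=; last by rewrite mem_index_iota; lia.
  rewrite (bigD1_seq Q) ?irreds_uniq //=; last first.
    by rewrite mem_irreds Qm sQ eqxx !andbT; apply/irreducibleP.
  rewrite eqxx mul1n big1 => [|P /negPf-> //]; rewrite addn0.
  rewrite big1_seq ?addn0 // => e /andP[ne _]; rewrite big1_seq // => P.
  rewrite mem_irreds => /andP[_ /and3P[_ _ /eqP Ps]].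
  have [PQ|//] := eqVneq P Q.
  by move: ne; rewrite -eqSS -sQ -Ps PQ eqxx.
rewrite -big_split; apply: eq_big_nat => e /andP[e_gt0 _].
rewrite -big_split; apply: eq_big_seq => P /=.
rewrite mem_irreds => /and3P[/irreducibleP Pi Pm /eqP Ps].
have [->|PQ] := eqVneq P Q; last first.
  rewrite addn0; apply: eq_bigr => j _; congr (nat_of_bool _ * _)%N.
  rewrite gQh Gauss_dvdpr // coprimep_expl // irreducible_poly_coprime //.
  apply: contra PQ => PdQ; rewrite -eqp_monic //.
  by apply: Qi.2 PdQ; rewrite neq_ltn orbC Pi.1.
(* [Q ^+ j.+1] divides [Q * h] iff [Q ^+ j] divides [h]: the range of [j] shifts by one, and the
   extra term [j = N] vanishes for reasons of degree. *)
rewrite mul1n big_nat_recl ?(leq_trans _ nN) //= Qg mul1n addnC; congr addn.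
rewrite [in RHS](@big_nat_recr _ _ _ N) //=; last by lia.
have /negPf-> : ~~ (Q ^+ N %| h).
  have Nh : (n.+1 - e0 < e0 * N)%N.
    by apply: (@leq_trans N); [lia|exact: leq_pmull].
  apply/negP => d.
  have : h \in [seq h <- monics (n.+1 - e0) | Q ^+ N %| h] by rewrite mem_filter d.
  by rewrite (monics_small (monicsX N Qe)).
rewrite mul0n addn0; apply: eq_bigr => j _; rewrite gQh exprS dvdp_mul2l //.
exact: monic_neq0.
Qed.

End Monics.

Lemma big_nat_multiples (R : nmodType) (G : nat -> R) e n : (0 < e)%N ->
  \sum_(1 <= j < n.+1 | (e * j <= n)%N) G (e * j)%N =
  \sum_(1 <= s < n.+1 | (e %| s)%N) G s.
Proof.
move=> e0; rewrite -big_filter -[RHS]big_filter -(big_map (muln e) xpredT).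
apply: perm_big; apply: uniq_perm.
- rewrite map_inj_uniq ?filter_uniq ?iota_uniq // => i j /eqP.
  by rewrite eqn_pmul2l // => /eqP.
- by rewrite filter_uniq ?iota_uniq.
move=> s; rewrite mem_filter mem_index_iota; apply/mapP/andP => [[j]|[/dvdnP[j ->]]].
  rewrite mem_filter mem_index_iota => /andP[ejn /andP[j0 _]] ->.
  by rewrite dvdn_mulr // muln_gt0 e0 j0 ltnS.
rewrite muln_gt0 ltnS => /andP[/andP[j0 _] jen]; exists j; last exact: mulnC.
rewrite mem_filter mem_index_iota mulnC jen j0 ltnS (leq_trans _ jen) //.
exact: leq_pmulr.
Qed.

Section EulerProduct.
Variables (k : finFieldType) (R : comNzRingType) (phi : {poly k} -> R).
Hypotheses (phi1 : phi 1 = 1) (phiM : forall g h, phi (g * h) = phi g * phi h).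

Definition lcoef n := \sum_(g <- monics k n) phi g.
(** Let [L(T)] be the series of the [lcoef n], that is, the product of [(1 - phi P * T ^ deg P)^-1]
    over the monic irreducible [P]. This is the coefficient of [T ^ s] in [T L'(T) / L(T)]. *)
Definition lambda s := \sum_(1 <= e < s.+1 | (e %| s)%N)
  \sum_(P <- irreds k e) phi P ^+ (s %/ e) *+ e.

Lemma lcoef0 : lcoef 0 = 1.
Proof. by rewrite /lcoef monics0 big_seq1. Qed.

Lemma phiX P j : phi (P ^+ j) = phi P ^+ j.
Proof. by elim: j => [|j IH]; rewrite ?expr0 // !exprS phiM IH. Qed.

Lemma lcoef_multiples n e P : P \in monics k e ->
  \sum_(g <- monics k n | P %| g) phi g =
  if (e <= n)%N then phi P * lcoef (n - e) else 0.
Proof.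
move=> Pe; case: leqP => [en|ne]; last first.
  by rewrite -big_filter (monics_small Pe ne) big_nil.
rewrite -big_filter (perm_big _ (perm_monics_mul Pe en)) big_map.
by rewrite mulr_sumr; apply: eq_bigr => g _; rewrite phiM.
Qed.

(** Compares coefficients in [T L' = (T L' / L) L]: each monic [g] is weighted by its degree, which
    is distributed over the prime powers [P ^+ j] dividing [g], and the multiples of each prime
    power are summed first. *)
Lemma lcoef_lambda n :
  lcoef n *+ n = \sum_(1 <= s < n.+1) lambda s * lcoef (n - s).
Proof.
transitivity (\sum_(1 <= e < n.+1) \sum_(P <- irreds k e)
    \sum_(1 <= j < n.+1 | (e * j <= n)%N) (phi P ^+ j * lcoef (n - e * j)) *+ e).
  transitivity (\sum_(g <- monics k n) \sum_(1 <= e < n.+1)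
    \sum_(P <- irreds k e) \sum_(1 <= j < n.+1) phi g *+ ((P ^+ j %| g)%R * e)).
    rewrite /lcoef -sumrMnl; apply: eq_big_seq => g gn.
    rewrite -[in LHS](degree_eq_sum_irreds (leqnn n) gn) -sumrMnr.
    apply: eq_bigr => e _; rewrite -sumrMnr; apply: eq_bigr => P _.
    by rewrite -sumrMnr.
  rewrite exchange_big; apply: eq_bigr => e _ /=.
  rewrite exchange_big; apply: eq_big_seq => P /=.
  rewrite mem_irreds => /and3P[_ Pm Ps].
  have Pe : P \in monics k e by rewrite mem_monics Pm.
  rewrite exchange_big [RHS]big_mkcond; apply: eq_bigr => j _ /=.
  have := lcoef_multiples n (monicsX j Pe); rewrite phiX.
  under eq_bigr do rewrite mulrnA mulrb.
  rewrite sumrMnl -big_mkcond /= => ->.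
  by case: ifP => // _; rewrite mul0rn.
transitivity (\sum_(1 <= s < n.+1) \sum_(1 <= e < n.+1 | (e %| s)%N)
    \sum_(P <- irreds k e) (phi P ^+ (s %/ e) * lcoef (n - s)) *+ e).
  rewrite (exchange_big_dep xpredT) //=; apply: eq_big_nat => e /andP[e0 _].
  rewrite [RHS]exchange_big /=; apply: eq_bigr => P _.
  rewrite -(big_nat_multiples (fun s => (phi P ^+ (s %/ e) * lcoef (n - s)) *+ e)) //.
  by apply: eq_bigr => j _; rewrite mulKn.
apply: eq_big_nat => s /andP[s0 sn]; rewrite /lambda mulr_suml.
rewrite [LHS](big_cat_nat (n := s.+1)) //=.
rewrite [X in _ + X]big_nat_cond [X in _ + X]big1 ?addr0.
  apply: eq_bigr => e _; rewrite mulr_suml; apply: eq_bigr => P _.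
  by rewrite mulrnAl.
by move=> e /andP[/andP[se _] /(dvdn_leq s0)]; rewrite leqNgt se.
Qed.

End EulerProduct.

(** * Power sums *)

Section Newton.
Variable C : fieldType.
Implicit Type ws : seq C.

Definition prod_1subX ws : {poly C} := \prod_(w <- ws) (1 - w *: 'X).
Definition power_sum ws s := \sum_(w <- ws) w ^+ s.

(* Logarithmic derivative of [prod_1subX], truncated at order [N]. *)
Lemma prod_1subX_deriv ws N : 'X^(N.+1) %|
  'X * (prod_1subX ws)^`() +
  (\sum_(s < N) power_sum ws s.+1 *: 'X^(s.+1)) * prod_1subX ws.
Proof.
elim: ws => [|w ws IH].
  rewrite /prod_1subX big_nil -polyC1 derivC mulr0 add0r mulr1 big1 ?dvdp0 //.
  by move=> s _; rewrite /power_sum big_nil scale0r.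
set E := prod_1subX ws in IH *; set PS := \sum_(s < N) _ in IH.
have -> : prod_1subX (w :: ws) = (1 - w *: 'X) * E by rewrite /prod_1subX big_cons.
have -> : \sum_(s < N) power_sum (w :: ws) s.+1 *: 'X^(s.+1) =
    PS + \sum_(s < N) (w *: 'X) ^+ s.+1 :> {poly C}.
  rewrite -big_split; apply: eq_bigr => s _.
  by rewrite /power_sum big_cons scalerDl addrC exprZn.
have geo : (1 - w *: 'X) * (\sum_(s < N) (w *: 'X) ^+ s.+1) =
    w *: 'X - (w *: 'X) ^+ N.+1.
  under eq_bigr do rewrite exprS; rewrite -mulr_sumr exprS.
  have -> (a b : {poly C}) : (1 - a) * (a * b) = - (a * ((a - 1) * b)) by ring.
  by rewrite -subrX1; ring.
rewrite derivM derivB derivZ derivX -polyC1 derivC sub0r polyC1 alg_polyC.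
have -> : 'X * (- w%:P * E + (1 - w *: 'X) * E^`()) + (PS +
    \sum_(s < N) (w *: 'X) ^+ s.+1) * ((1 - w *: 'X) * E) =
    (1 - w *: 'X) * ('X * E^`() + PS * E) - (w *: 'X) * E +
    ((1 - w *: 'X) * (\sum_(s < N) (w *: 'X) ^+ s.+1)) * E.
  by rewrite -mul_polyC; ring.
rewrite geo.
have -> : forall a b c d : {poly C}, a - b * c + (b - d) * c = a - d * c.
  by move=> *; ring.
apply: dvdp_sub; first exact: dvdp_mull.
by apply: dvdp_mulr; rewrite exprZn -mul_polyC dvdp_mull.
Qed.

Lemma newton_identity ws n : (prod_1subX ws)`_n *+ n =
  - \sum_(1 <= s < n.+1) power_sum ws s * (prod_1subX ws)`_(n - s).
Proof.
have /dvdpP[Q] := prod_1subX_deriv ws n.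
move/(congr1 (fun p : {poly C} => p`_n)); rewrite coefMXn ltnSn coefD coefXM.
rewrite coef_deriv; case: n => [|n]; first by rewrite big_geq // oppr0.
rewrite /= => /eqP; rewrite addr_eq0 => /eqP->; congr (- _).
rewrite coefM big_ord_recl coef_sum big1 ?mul0r ?add0r; last first.
  by move=> s _; rewrite coefZ coefXn /= mulr0.
rewrite big_add1 big_mkord; apply: eq_bigr => i _; congr (_ * _).
rewrite coef_sum (bigD1 i) //= coefZ coefXn eqxx mulr1 big1 ?addr0 // => j ji.
rewrite coefZ coefXn /bump /= add1n eqSS; case: eqP => [e|_]; last exact: mulr0.
by move: ji; rewrite -val_eqE /= e eqxx.
Qed.

(** The constant coefficient being 1, the recurrence gives each [L n] from the previous ones without
    a division by [n], and [newton_identity] is the same recurrence for the opposite power sums. *)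
Lemma newton_uniq ws (L : nat -> C) :
  (forall n, (prod_1subX ws)`_n *+ n =
     \sum_(1 <= s < n.+1) L s * (prod_1subX ws)`_(n - s)) ->
  forall n, (0 < n)%N -> L n = - power_sum ws n.
Proof.
move=> LE; elim/ltn_ind => n IH n0; have := LE n; rewrite newton_identity.
rewrite !big_nat_recr //= subnn.
have -> : (prod_1subX ws)`_0 = 1.
  rewrite -horner_coef0 /prod_1subX horner_prod big1 // => w _.
  by rewrite !hornerE subr0.
rewrite !mulr1 => /eqP; rewrite opprD -sumrN.
rewrite (eq_big_nat _ _ (F2 := fun s => L s * (prod_1subX ws)`_(n - s))).
  by move/eqP/addrI.
by move=> s /andP[s0 sn]; rewrite IH // mulNr.
Qed.

End Newton.

(** The [ws] are the inverses of the roots of the polynomial with coefficients [c], which are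
    nonzero as [c 0 = 1]; its degree is below [m]. *)
Lemma prod_1subX_exists (C : closedFieldType) (c : nat -> C) m :
  c 0%N = 1 -> (forall n, (m <= n)%N -> c n = 0) ->
  exists2 ws, (size ws < m)%N & forall n, (prod_1subX ws)`_n = c n.
Proof.
move=> c0 cm; have m0 : (0 < m)%N.
  rewrite lt0n; apply/eqP => me; move: (cm 0%N); rewrite me c0 => /(_ isT)/eqP.
  by rewrite oner_eq0.
pose L : {poly C} := \poly_(i < m) c i.
have LE n : L`_n = c n by rewrite coef_poly; case: ltnP => // /cm.
have [rs Lrs] := closed_field_poly_normal L.
have L0 : L != 0.
  apply/eqP => /(congr1 (fun p : {poly C} => p`_0)); rewrite LE c0 coef0 => /eqP.
  by rewrite oner_eq0.
have nr r : r \in rs -> r != 0.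
  move=> rrs; apply/eqP => r0; have : root L r.
    by rewrite Lrs rootZ ?lead_coef_eq0 // root_prod_XsubC.
  by rewrite r0 rootE horner_coef0 LE c0 oner_eq0.
have Lws : L = (lead_coef L * \prod_(r <- rs) - r) *: prod_1subX [seq r^-1 | r <- rs].
  rewrite {1}Lrs -scalerA; congr (_ *: _); rewrite /prod_1subX big_map.
  rewrite -mul_polyC rmorph_prod /= -big_split; apply: eq_big_seq => r /nr r0 /=.
  rewrite mulrBr mulr1 mul_polyC scalerA mulNr divff // scaleN1r opprK polyCN.
  by rewrite addrC.
have P0 : (prod_1subX [seq r^-1 | r <- rs])`_0 = 1.
  rewrite -horner_coef0 /prod_1subX horner_prod big1 // => w _.
  by rewrite !hornerE subr0.
exists [seq r^-1 | r <- rs].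
  rewrite size_map -ltnS -(size_prod_XsubC _ id).
  rewrite -(size_scale _ (a := lead_coef L)) ?lead_coef_eq0 //.
  by rewrite -Lrs ltnS size_poly.
move=> n; rewrite -LE Lws coefZ.
have /(congr1 (fun p : {poly C} => p`_0)) := Lws.
by rewrite LE c0 coefZ P0 mulr1 => <-; rewrite mul1r.
Qed.

Section PowerSumGrowth.
Variable C : numClosedFieldType.
Hypothesis archC : forall x : C, exists n : nat, `|x| < n%:R.

Lemma bounded_powers (x : C) K r0 : 0 <= x ->
  (forall r, (r0 <= r)%N -> x ^+ r <= K) -> x <= 1.
Proof.
move=> x0 xK; rewrite real_leNgt ?ger0_real ?ler01 //; apply/negP => x1.
have b r : 1 + (x - 1) *+ r <= x ^+ r.
  elim: r => [|r IH]; first by rewrite mulr0n addr0 expr0.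
  rewrite exprS (le_trans _ (ler_wpM2l x0 IH)) // -subr_ge0.
  have -> : x * (1 + (x - 1) *+ r) - (1 + (x - 1) *+ r.+1) = (x - 1) ^+ 2 *+ r.
    rewrite mulrS -[(x - 1) *+ r]mulr_natr -[(x - 1) ^+ 2 *+ r]mulr_natr; ring.
  by rewrite mulrn_wge0 // exprn_ge0 // subr_ge0 ltW.
have xp : 0 < x - 1 by rewrite subr_gt0.
have [n] := archC (K / (x - 1)).
have K1 : 1 <= K by apply: le_trans (xK r0 (leqnn _)); rewrite exprn_ege1 // ltW.
rewrite ger0_norm; last exact: divr_ge0 (le_trans ler01 K1) (ltW xp).
rewrite ltr_pdivrMr // mulr_natl => Kn.
suff /(lt_le_trans Kn) : (x - 1) *+ n <= K by rewrite ltxx.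
apply: le_trans (xK _ (leq_maxr n r0)); apply: le_trans (b _).
rewrite -[X in X <= _]add0r lerD ?ler01 //.
by rewrite ler_wpMn2l ?leq_maxl // ltW.
Qed.

(* A single summand [b ^ r] is recovered from [power_sum bs] at
   [r, r + 1, ...] by a polynomial vanishing at all the other terms. *)
Lemma power_sum_growth (bs : seq C) (rho K : C) r0 : 0 < rho ->
  (forall r, (r0 <= r)%N -> `|power_sum bs r| <= K * rho ^+ r) ->
  forall b, b \in bs -> `|b| <= rho.
Proof.
move=> rho0 bK b bbs; pose Q := \prod_(u <- undup bs | u != b) ('X - u%:P).
have Qb : Q.[b] != 0.
  rewrite horner_prod prodf_seq_neq0; apply/allP => u _; apply/implyP => ub.
  by rewrite !hornerE subr_eq0 eq_sym.
have Q0 u : u \in bs -> u != b -> Q.[u] = 0.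
  move=> ubs ub; rewrite horner_prod -big_filter (bigD1_seq u) /=.
  - by rewrite !hornerE subrr mul0r.
  - by rewrite mem_filter ub mem_undup.
  - by rewrite filter_uniq ?undup_uniq.
have sumQ r : \sum_(i < size Q) Q`_i * power_sum bs (r + i) =
    (b ^+ r * Q.[b]) *+ count_mem b bs.
  under eq_bigr do rewrite mulr_sumr.
  rewrite exchange_big /= -iter_addr_0 -big_const_seq [RHS]big_mkcond.
  apply: eq_big_seq => u ubs; have -> : \sum_(i < size Q) Q`_i * u ^+ (r + i) =
      u ^+ r * Q.[u].
    by rewrite horner_coef mulr_sumr; apply: eq_bigr => i _; rewrite exprD; ring.
  by rewrite /=; case: (eqVneq u b) => [->//|ub]; rewrite (Q0 _ ubs ub) mulr0.
pose S := \sum_(i < size Q) `|Q`_i| * K * rho ^+ i.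
have cb : (0 < count_mem b bs)%N by rewrite -has_count has_pred1.
have rho_n0 : rho != 0 by rewrite gt_eqF.
have bS r : (r0 <= r)%N -> (`|b| / rho) ^+ r <= S / `|Q.[b]|.
  move=> rr; rewrite ler_pdivlMr ?normr_gt0 // expr_div_n mulrAC.
  rewrite ler_pdivrMr ?exprn_gt0 // -normrX -normrM.
  apply: (@le_trans _ _ `|(b ^+ r * Q.[b]) *+ count_mem b bs|).
    by rewrite normrMn -[X in X <= _]mulr1n ler_wpMn2l.
  rewrite -sumQ (le_trans (ler_norm_sum _ _ _)) // /S mulr_suml ler_sum // => i _.
  rewrite normrM -!mulrA ler_wpM2l // -exprD addnC.
  by apply: bK; rewrite (leq_trans rr) // leq_addl.
have := bounded_powers (divr_ge0 (normr_ge0 b) (ltW rho0)) bS.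
by rewrite ler_pdivrMr // mul1r.
Qed.

(** Up to sign, [L] at multiples of [2 * m] gives the power sums of the [w ^+ (2 * m)]. Their growth
    bounds [|w| ^ (2 m)] by [q ^ m], so each of the at most [m - 1] numbers [w] has modulus at most
    [sqrt q], and [c 1] is minus their sum. *)
Lemma lcoef1_bound (c L : nat -> C) m q r0 (K : C) :
  (0 < q)%N -> c 0%N = 1 -> (forall n, (m <= n)%N -> c n = 0) ->
  (forall n, c n *+ n = \sum_(1 <= s < n.+1) L s * c (n - s)%N) ->
  (forall r, (r0 <= r)%N -> `|L (2 * m * r)%N| <= K * (q ^ m)%:R ^+ r) ->
  `|c 1%N| <= (m - 1)%:R * sqrtC q%:R.
Proof.
move=> q0 c0 cm cL LK; have [ws ws_m wsc] := prod_1subX_exists c0 cm.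
have Lws : forall n, (0 < n)%N -> L n = - power_sum ws n.
  apply: newton_uniq => n; rewrite wsc cL; apply: eq_bigr => s _.
  by rewrite wsc.
have m0 : (0 < m)%N by apply: leq_ltn_trans ws_m.
have sq0 : 0 <= sqrtC q%:R :> C by rewrite sqrtC_ge0.
have ws_le w : w \in ws -> `|w| <= sqrtC q%:R.
  move=> wws; have m20 : (0 < 2 * m)%N by rewrite muln_gt0.
  rewrite -(ler_pXn2r m20) ?nnegrE // -normrX [X in _ <= X]exprM sqrtCK -natrX.
  (* The index 0 is left out: [newton_uniq] relates [L] to power sums at positive indices only. *)
  apply: (@power_sum_growth [seq w ^+ (2 * m) | w <- ws] _ K (maxn r0 1)).
  - by rewrite ltr0n expn_gt0 q0.
  - move=> r; rewrite geq_max => /andP[rr r_gt0].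
    rewrite /power_sum big_map; under eq_bigr do rewrite -exprM.
    by rewrite -normrN -Lws ?LK // muln_gt0 m20.
  - exact: map_f.
have := cL 1%N; rewrite mulr1n big_nat1 subnn c0 mulr1 => ->.
rewrite Lws // normrN (le_trans (ler_norm_sum _ _ _)) //.
rewrite big_seq; apply: (@le_trans _ _ (\sum_(w <- ws | w \in ws) sqrtC q%:R)).
  by apply: ler_sum => w; rewrite expr1; apply: ws_le.
rewrite -big_seq big_const_seq count_predT iter_addr_0 -[_ *+ size ws]mulr_natl.
by rewrite ler_wpM2r // ler_nat; lia.
Qed.

End PowerSumGrowth.

(** * Conjugates over a finite field *)

(** In the quotient field by [P], whose order is [#|k| ^ deg P], every element is fixed by this
    power. *)
Lemma irreducible_dvd_card (k : finFieldType) (P : {poly k}) r :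
  P \is monic -> irreducible_poly P ->
  P %| 'X^(#|k| ^ ((size P).-1 * r)) - 'X.
Proof.
move=> Pm Pi; pose mi : monic_irreducible_poly P := (Pi, Pm).
have : in_qpoly P ('X^(#|k| ^ ((size P).-1 * r)) - 'X) = 0.
  rewrite rmorphB rmorphXn /= expnM -(card_qfpoly mi).
  by apply/eqP; rewrite subr_eq0; apply/eqP; apply: (@expf_cardX {poly %/ P with mi}).
move/(congr1 val) => /=; rewrite -Pdiv.IdomainMonic.modpE (mk_monicE mi) // => e.
by rewrite /dvdp e.
Qed.

Section Conjugates.
Variables (E : finFieldType) (q s : nat).
Hypotheses (q_nat : [pchar E].-nat q) (card_E : #|E| = (q ^ s)%N) (s_gt0 : (0 < s)%N).
Implicit Type a : E.

Definition conjs a e := [seq a ^+ (q ^ i) | i <- iota 0 e].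

Lemma frob_inj n : injective (fun x : E => x ^+ (q ^ n)).
Proof.
move=> x y /eqP; rewrite -subr_eq0 -exprBn_pchar ?pnatX ?q_nat //.
by rewrite expf_eq0 subr_eq0 => /andP[_ /eqP].
Qed.

Lemma conjs_uniq a e :
  (forall i, (0 < i < e)%N -> a ^+ (q ^ i) != a) -> uniq (conjs a e).
Proof.
move=> ae; rewrite map_inj_in_uniq ?iota_uniq // => i j.
rewrite !mem_iota !add0n /=; wlog ij : i j / (i <= j)%N => [H ie je e'|].
  by have [/H->|/ltnW/H->] := leqP i j.
move=> ie je; rewrite -{1}(subnK ij) expnD exprM => /frob_inj/esym/eqP H.
apply/eqP; rewrite eqn_leq ij leqNgt; apply/negP => lt_ij.
have /negP : a ^+ (q ^ (j - i)) != a.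
  by apply: ae; rewrite subn_gt0 lt_ij (leq_ltn_trans (leq_subr _ _) je).
by rewrite H.
Qed.

Lemma conjs_period a : exists2 e, (e %| s)%N & [/\ (0 < e)%N, a ^+ (q ^ e) = a &
  forall i, (0 < i < e)%N -> a ^+ (q ^ i) != a].
Proof.
have aX e n : a ^+ (q ^ e) = a -> a ^+ (q ^ (e * n)) = a.
  by move=> ae; elim: n => [|n IH]; rewrite ?muln0 // mulnS expnD exprM ae.
have as_ : a ^+ (q ^ s) = a by rewrite -card_E expf_card.
have ex : exists e, (0 < e)%N && (a ^+ (q ^ e) == a).
  by exists s; rewrite s_gt0 as_ eqxx.
have [e /andP[e0 /eqP ae] emin] := ex_minnP ex.
have mi i : (0 < i < e)%N -> a ^+ (q ^ i) != a.
  move=> /andP[i0 ie]; apply/negP => ai.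
  by have := emin i; rewrite i0 ai leqNgt ie => /(_ isT).
exists e => //; rewrite /dvdn; apply: contraT; rewrite -lt0n => r0.
have := mi (s %% e)%N; rewrite r0 ltn_mod e0 => /(_ isT)/eqP; case.
by have := as_; rewrite {1}(divn_eq s e) [(_ * e)%N]mulnC expnD exprM aX.
Qed.

End Conjugates.

Section MinimalPolynomial.
Variables (k E : finFieldType) (j : {rmorphism k -> E}) (s : nat).
Let q := #|k|.
Hypotheses (card_E : #|E| = (q ^ s)%N) (s_gt0 : (0 < s)%N).
Local Notation "P ^j" := (map_poly j P) (at level 2).

Lemma pchar_nat_base : [pchar E].-nat q.
Proof. exact/(pchar_nat_rmorph j)/pchar_nat_card. Qed.

(** ['X^q - 'X] already has [q] roots in [k]. *)
Lemma frob_fixed_in_base (x : E) : x ^+ q = x -> exists y, x = j y.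
Proof.
move=> xq; have : root ('X^q - 'X)^j x.
  by rewrite rmorphB /= map_polyXn map_polyX rootE !hornerE xq subrr.
rewrite finField_genPoly map_prod_XsubC.
rewrite -big_enum -(big_map j xpredT (fun z => 'X - z%:P)) root_prod_XsubC.
by move=> /mapP[y _ ->]; exists y.
Qed.

Lemma root_conjs (P : {poly k}) a e : root P^j a -> all (root P^j) (conjs q a e).
Proof.
move=> Pa; apply/allP => _ /mapP[i _ ->]; elim: i => [//|i].
rewrite expnSr exprM; move: (a ^+ _) => b /eqP Pb.
rewrite rootE horner_coef; under eq_bigr => l _.
  rewrite coef_map /= -exprM mulnC exprM -[P`_l]expf_card rmorphXn -exprMn /=.
  over.
rewrite -expr_sum_pchar ?pchar_nat_base //.
have := Pb; rewrite horner_coef; under eq_bigr do rewrite coef_map /=.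
by move=> ->; rewrite expr0n gtn_eqF //; case/andP: pchar_nat_base.
Qed.

(** The [q]-th power map permutes the conjugates cyclically, so it fixes the coefficients of the
    product, which therefore come from [k]. *)
Lemma conjs_poly a e : a ^+ (q ^ e) = a ->
  exists G : {poly k}, G^j = \prod_(z <- conjs q a e) ('X - z%:P).
Proof.
move=> ae; set g := \prod_(z <- _) _.
have frB : zmod_morphism (fun x : E => x ^+ q).
  by move=> x y; rewrite exprBn_pchar ?pchar_nat_base.
have frM : monoid_morphism (fun x : E => x ^+ q).
  by split=> [|x y]; rewrite ?expr1n ?exprMn.
pose fr : {rmorphism E -> E} := HB.pack (fun x : E => x ^+ q)
  (GRing.isZmodMorphism.Build E E _ frB) (GRing.isMonoidMorphism.Build E E _ frM).
have gfr : map_poly fr g = g.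
  rewrite /g (map_prod_XsubC fr) -(big_map fr xpredT (fun z => 'X - z%:P)); apply: perm_big.
  rewrite /conjs -map_comp; case: (e) ae => // e' ae.
  have -> : map (fr \o (fun i => a ^+ (q ^ i))) (iota 0 e'.+1) =
      map (fun i => a ^+ (q ^ i)) (iota 1 e'.+1).
    rewrite (iotaDl 1 0) -map_comp; apply: eq_map => i /=.
    by rewrite -exprM add1n expnSr.
  by rewrite -{1}(addn1 e') iotaD map_cat /= add1n ae expr1 cats1 perm_rcons.
have gj i : exists y, g`_i = j y.
  by apply: frob_fixed_in_base; rewrite -{2}gfr coef_map.
have [y gy] := boolp.choice gj; exists (\poly_(i < size g) y i).
apply/polyP => i; rewrite coef_map coef_poly; case: ltnP => [_|gi]; first by rewrite gy.
by rewrite (nth_default _ gi); apply: raddf0.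
Qed.

(** The product over a full period of conjugates descends to [k] and divides [P], since all
    conjugates are roots; irreducibility makes it equal to [P]. *)
Lemma irreducible_conjs (P : {poly k}) a e : P \is monic -> irreducible_poly P ->
  root P^j a -> (size P).-1 = e ->
  [/\ (e %| s)%N, a ^+ (q ^ e) = a, uniq (conjs q a e) &
    P^j = \prod_(z <- conjs q a e) ('X - z%:P)].
Proof.
move=> Pm Pi Pa Pe.
have [e' e's [e'0 ae' amin]] := conjs_period card_E s_gt0 a.
have U := conjs_uniq pchar_nat_base amin.
have [G Gj] := conjs_poly ae'.
have GP : G %| P.
  by rewrite -(dvdp_map j) Gj uniq_roots_dvdp ?uniq_rootsE ?root_conjs.
have Gs : size G = e'.+1.
  by rewrite -(size_map_poly j) Gj size_prod_XsubC size_map size_iota.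
have GPe : G = P.
  apply/eqP; rewrite -eqp_monic //; first by apply: Pi.2 => //; rewrite Gs; lia.
  by rewrite -(map_monic j) Gj monic_prod_XsubC.
have ee' : e = e' by rewrite -Pe -GPe Gs.
by rewrite ee' -GPe.
Qed.

(** The product over the conjugates of [a] is its minimal polynomial: a nonconstant divisor over [k]
    vanishes at one conjugate, hence at all of them. *)
Lemma irreducible_root_exists a : exists e P,
  [/\ (0 < e)%N, (e %| s)%N, P \in irreds k e & root P^j a].
Proof.
have [e es [e0 ae amin]] := conjs_period card_E s_gt0 a.
have U := conjs_uniq pchar_nat_base amin.
have [G Gj] := conjs_poly ae.
have Gs : size G = e.+1.
  by rewrite -(size_map_poly j) Gj size_prod_XsubC size_map size_iota.
have Gm : G \is monic by rewrite -(map_monic j) Gj monic_prod_XsubC.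
have ac : a \in conjs q a e.
  by apply/mapP; exists 0%N; rewrite ?mem_iota ?expr1.
exists e, G; split=> //; last by rewrite Gj root_prod_XsubC.
rewrite mem_irreds Gm Gs eqxx !andbT; apply/irreducibleP; split=> [|Q Q1 QG].
  by rewrite Gs ltnS.
have := QG; rewrite -(dvdp_map j) Gj => /dvdp_prod_XsubC[ms Qms].
have Q0 : Q != 0 by apply: dvdpN0 QG _; rewrite monic_neq0.
have [z zms] : exists z : E, z \in mask ms (conjs q a e).
  case: (mask _ _) Qms => [|z l]; last by exists z; rewrite mem_head.
  by move/eqp_size; rewrite big_nil size_map_poly size_poly1 => /eqP; rewrite (negPf Q1).
have Qz : root Q^j z by rewrite (eqp_root Qms) root_prod_XsubC.
have /mapP[l] := mem_mask zms; rewrite mem_iota add0n /= => le zl.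
(* [a] is recovered from its conjugate [z] by [e - l] more Frobenius steps; this number is [e] when
   [l = 0], hence the list of [e.+1] conjugates. *)
have Qa : root Q^j a.
  have /allP := root_conjs e.+1 Qz; apply; apply/mapP; exists (e - l)%N.
    by rewrite mem_iota; lia.
  by rewrite zl -exprM -expnD subnKC // ltnW.
rewrite -dvdp_size_eqp // eqn_leq dvdp_leq ?monic_neq0 //= Gs.
rewrite -(size_map_poly j) -(size_iota 0 e) -(size_map (fun i => a ^+ (q ^ i))).
by apply: max_poly_roots; rewrite ?map_poly_eq0 ?root_conjs.
Qed.

End MinimalPolynomial.

(** * Power residue characters *)

(* A multiplicative character if [gamma] and [zeta] have order [D]; its value is
   [0] where [x ^ N] is not a power of [gamma]. *)
Definition powchar (C : nzRingType) (E : fieldType) (N D : nat) (zeta : C)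
  (gamma x : E) : C := \sum_(j < D) zeta ^+ j *+ (x ^+ N == gamma ^+ j).

Lemma powchar_rmorph (C : nzRingType) (K E : fieldType) (i : {rmorphism K -> E})
    N D (zeta : C) gamma x :
  powchar N D zeta (i gamma) (i x) = powchar N D zeta gamma x.
Proof.
by apply: eq_bigr => j _; rewrite -!rmorphXn (inj_eq (fmorph_inj i)).
Qed.

Lemma prim_root_neq0 (F : fieldType) n (z : F) : n.-primitive_root z -> z != 0.
Proof.
move=> zp; apply/eqP => z0; have /eqP := prim_expr_order zp.
by rewrite z0 expr0n gtn_eqF ?(prim_order_gt0 zp) // eq_sym oner_eq0.
Qed.

Section PowChar.
Variables (C : comNzRingType) (K : finFieldType) (N D : nat) (zeta : C) (h : K).
Hypotheses (card_K : (#|K|.-1 = D * N)%N) (D_gt1 : (1 < D)%N).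
Hypotheses (h_prim : (#|K|.-1).-primitive_root h) (zeta_prim : D.-primitive_root zeta).
Local Notation chi := (powchar N D zeta (h ^+ N)).

Let N_gt0 : (0 < N)%N.
Proof. by have := prim_order_gt0 h_prim; rewrite card_K muln_gt0 => /andP[]. Qed.

Let gamma_prim : D.-primitive_root (h ^+ N).
Proof.
have DK : (D %| #|K|.-1)%N by rewrite card_K dvdn_mulr.
by have := dvdn_prim_root h_prim DK; rewrite card_K mulKn // ltnW.
Qed.

Let h_neq0 : h != 0. Proof. exact: prim_root_neq0 h_prim. Qed.

Lemma powchar_gen i : chi (h ^+ i) = zeta ^+ i.
Proof.
have D0 := ltnW D_gt1.
rewrite /powchar (bigD1 (Ordinal (ltn_pmod i D0))) //= big1 ?addr0.
  rewrite -exprM mulnC exprM (eq_prim_root_expr gamma_prim) modn_mod eqxx.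
  by rewrite mulr1n (prim_expr_mod zeta_prim).
move=> j ji; rewrite -exprM mulnC exprM (eq_prim_root_expr gamma_prim).
rewrite [(j %% D)%N]modn_small // eq_sym.
by move: ji; rewrite -val_eqE /= => /negPf->; rewrite mulr0n.
Qed.

Lemma prim_root_gen x : x != 0 -> exists i, x = h ^+ i.
Proof.
move=> x0; have := prim_rootP h_prim (x := x); case.
  apply: (mulfI x0); rewrite mulr1 -exprS prednK ?expf_card //.
  by rewrite ltnW // card_finNzRing_gt1.
by move=> i ->; exists i.
Qed.

Lemma powchar0 : chi 0 = 0.
Proof.
rewrite /powchar big1 // => j _; rewrite expr0n gtn_eqF // eq_sym.
by rewrite !expf_eq0 (negPf h_neq0) !andbF mulr0n.
Qed.

Lemma powchar1 : chi 1 = 1.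
Proof. by rewrite -[1 in LHS](expr0 h) powchar_gen expr0. Qed.

Lemma powcharM x y : chi (x * y) = chi x * chi y.
Proof.
have [->|/prim_root_gen[i ->]] := eqVneq x 0; first by rewrite mul0r powchar0 mul0r.
have [->|/prim_root_gen[j ->]] := eqVneq y 0; first by rewrite mulr0 powchar0 mulr0.
by rewrite -exprD !powchar_gen exprD.
Qed.

Lemma powcharX x n : chi (x ^+ n) = chi x ^+ n.
Proof.
by elim: n => [|n IH]; rewrite ?expr0 ?powchar1 // !exprS powcharM IH.
Qed.

End PowChar.

(** Multiplication by [h] permutes [K] and scales the sum by [zeta], which is not 1. *)
Lemma powchar_sum (C : idomainType) (K : finFieldType) N D (zeta : C) (h : K) :
  (#|K|.-1 = D * N)%N -> (1 < D)%N -> (#|K|.-1).-primitive_root h ->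
  D.-primitive_root zeta -> \sum_x powchar N D zeta (h ^+ N) x = 0.
Proof.
move=> card_K D1 hp zp; set S := LHS.
have h0 := prim_root_neq0 hp.
have : zeta * S = S.
  rewrite [in RHS]/S (reindex_inj (mulfI h0)) mulr_sumr; apply: eq_bigr => x _ /=.
  by rewrite powcharM // -[h in RHS]expr1 powchar_gen.
move/eqP; rewrite -subr_eq0 -[X in _ - X]mul1r -mulrBl mulf_eq0 subr_eq0.
case/predU1P => [z1|/eqP//].
have := prim_order_dvd zp 1; rewrite expr1 z1 eqxx dvdn1 => /eqP D_1.
by rewrite D_1 in D1.
Qed.

(** * Evaluation of monic polynomials at a generator of the extension *)

Section Evaluation.
Variables (k K : finFieldType) (i : {rmorphism k -> K}) (m : nat) (v : K).
Let q := #|k|.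
Hypotheses (card_K : #|K| = (q ^ m)%N).
Hypothesis v_gen : forall l, (0 < l < m)%N -> v ^+ (q ^ l) != v.

Definition ev (g : {poly k}) : K := (map_poly i g).[v].

(** A nonzero polynomial of size at most [m] cannot vanish at the [m] distinct conjugates of [v], so
    evaluation is injective on these polynomials, and bijective by counting. *)
Lemma ev_surj n y : (m <= n)%N -> exists u : 'rV[k]_n, ev (rVpoly u) = y.
Proof.
move=> mn; pose h (u : 'rV[k]_m) := ev (rVpoly u).
have hinj : injective h.
  move=> u1 u2 /eqP; rewrite -subr_eq0 /h /ev -hornerN -hornerD -!rmorphB /= -linearB.
  move=> r0; apply/eqP; rewrite -subr_eq0; apply: contraT => u0.
  have p0 : rVpoly (u1 - u2) != 0.
    by apply: contra u0 => /eqP p0; rewrite -[u1 - u2]rVpolyK p0 linear0.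
  have : root (map_poly i (rVpoly (u1 - u2))) v by [].
  move/(@root_conjs _ _ _ _ _ m) => rc.
  have := max_poly_roots _ rc (conjs_uniq (pchar_nat_base i) v_gen).
  rewrite map_poly_eq0 p0 size_map size_iota size_map_poly => /(_ isT).
  by rewrite ltnNge size_poly.
have [|h' hK h'K] := inj_card_bij hinj; first by rewrite card_mx mul1n card_K.
exists (poly_rV (rVpoly (h' y))); rewrite poly_rV_K ?(leq_trans _ mn) ?size_poly //.
exact: h'K.
Qed.

(** By [ev_surj], a translation of the coefficients shifts the value at [v] by an arbitrary [y];
    summing over [y] then produces the sum of [f]. For a character, this is the vanishing of
    [lcoef n] when [n >= m]. *)
Lemma sum_ev_monics (C : numDomainType) (f : K -> C) n : (m <= n)%N ->
  \sum_y f y = 0 -> \sum_(g <- monics k n) f (ev g) = 0.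
Proof.
move=> mn f0; rewrite big_map big_enum /=.
have evD g1 g2 : ev (g1 + g2) = ev g1 + ev g2 by rewrite /ev rmorphD hornerD.
have tr y : \sum_(u : 'rV[k]_n) f (ev ('X^n + rVpoly u)) =
    \sum_(u : 'rV[k]_n) f (ev ('X^n + rVpoly u) + y).
  have [u0 <-] := ev_surj y mn; rewrite [LHS](reindex_inj (addIr u0)) /=.
  by apply: eq_bigr => u _; rewrite linearD /= addrA evD.
have : \sum_(y : K) \sum_(u : 'rV[k]_n) f (ev ('X^n + rVpoly u)) = 0.
  rewrite (eq_bigr _ (fun y _ => tr y)) exchange_big /= big1 // => u _.
  by rewrite -[RHS]f0 [RHS](reindex_inj (addrI (ev ('X^n + rVpoly u)))).
rewrite sumr_const => /eqP; rewrite mulrn_eq0 => /orP[|/eqP//].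
by rewrite cardT -cardE gtn_eqF // ltnW // card_finNzRing_gt1.
Qed.

End Evaluation.

(** * Prime power sums as character sums over an extension *)

Section LambdaSum.
Variables (C : comNzRingType) (k K E : finFieldType).
Variables (i : {rmorphism k -> K}) (i' : {rmorphism K -> E}) (v : K) (s : nat).
Let q := #|k|.
Hypotheses (card_E : #|E| = (q ^ s)%N) (s_gt0 : (0 < s)%N).
Variables (N D : nat) (zeta : C) (h : K).
Hypotheses (card_K : (#|K|.-1 = D * N)%N) (D_gt1 : (1 < D)%N).
Hypotheses (h_prim : (#|K|.-1).-primitive_root h) (zeta_prim : D.-primitive_root zeta).

Let chi := powchar N D zeta (h ^+ N).
(** The argument of [powchar] is the value at [v] of the characteristic polynomial of [a] over
    [k]. *)
Let theta (a : E) :=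
  powchar N D zeta (i' (h ^+ N)) (\prod_(l < s) (i' v - a ^+ (q ^ l))).
Let j : {rmorphism k -> E} := i' \o i.

Lemma prod_conjs_period (x a : E) e n : a ^+ (q ^ e) = a ->
  \prod_(l < e * n) (x - a ^+ (q ^ l)) = (\prod_(l < e) (x - a ^+ (q ^ l))) ^+ n.
Proof.
move=> ae; elim: n => [|n IH]; first by rewrite muln0 big_ord0.
rewrite mulnS big_split_ord exprS -IH; congr (_ * _); apply: eq_bigr => l _ /=.
by rewrite expnD exprM ae.
Qed.

(** The characteristic polynomial of [a] is the power [s %/ e] of its minimal polynomial [P]. *)
Lemma theta_root e P a : (e %| s)%N -> P \in irreds k e ->
  root (map_poly j P) a -> theta a = chi (ev i v P) ^+ (s %/ e).
Proof.
move=> es; rewrite mem_irreds => /and3P[/irreducibleP Pi Pm /eqP Ps] Pa.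
have [_ ae _ Pj] := irreducible_conjs card_E s_gt0 Pm Pi Pa (congr1 predn Ps).
have -> : theta a = powchar N D zeta (i' (h ^+ N))
    ((\prod_(l < e) (i' v - a ^+ (q ^ l))) ^+ (s %/ e)).
  by rewrite -prod_conjs_period // mulnC divnK.
have -> : \prod_(l < e) (i' v - a ^+ (q ^ l)) = i' (ev i v P).
  rewrite /ev -horner_map -map_poly_comp Pj horner_prod big_map.
  rewrite -[e in iota 0 e]subn0 -[iota _ _]/(index_iota 0 e) big_mkord.
  by apply: eq_bigr => l _; rewrite !hornerE.
by rewrite -rmorphXn powchar_rmorph powcharX.
Qed.

(** [P] divides ['X^#|E| - 'X], hence has a root in [E]; its roots are then the [e] distinct
    conjugates of this one. *)
Lemma card_irreducible_roots e P : (e %| s)%N -> P \in irreds k e ->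
  #|[set a | root (map_poly j P) a]| = e.
Proof.
move=> es; rewrite mem_irreds => /and3P[/irreducibleP Pi Pm /eqP Ps].
have e1 : (0 < e)%N by have := Pi.1; rewrite Ps.
have [a Pa] : exists a, root (map_poly j P) a.
  have := irreducible_dvd_card (s %/ e) Pm Pi; rewrite Ps /= mulnC divnK //.
  rewrite -(dvdp_map j) rmorphB /= map_polyXn map_polyX -/q -card_E.
  rewrite finField_genPoly -big_enum => /dvdp_prod_XsubC[ms].
  case: (mask _ _) => [|a l] Pms.
    by move/eqp_size: Pms; rewrite big_nil size_map_poly Ps size_poly1; lia.
  by exists a; rewrite (eqp_root Pms) root_prod_XsubC mem_head.
have [_ _ U Pj] := irreducible_conjs card_E s_gt0 Pm Pi Pa (congr1 predn Ps).
have /eq_card-> : [set a | root (map_poly j P) a] =i conjs q a e.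
  by move=> b; rewrite inE Pj root_prod_XsubC.
by rewrite (card_uniqP U) size_map size_iota.
Qed.

(** Every [a] in [E] is a root of exactly one monic irreducible polynomial, of degree [e] dividing
    [s]; the weight [e] in [lambda] counts its roots. *)
Lemma lambda_sum : lambda (fun g => chi (ev i v g)) s = \sum_a theta a.
Proof.
transitivity (\sum_(1 <= e < s.+1 | (e %| s)%N) \sum_(P <- irreds k e)
    \sum_(a | root (map_poly j P) a) theta a).
  apply: eq_bigr => e es; apply: eq_big_seq => P Pe.
  rewrite (eq_bigr (fun=> chi (ev i v P) ^+ (s %/ e))); last first.
    by move=> a Pa; rewrite (theta_root es Pe).
  by rewrite sumr_const -(card_irreducible_roots es Pe) cardsE.
under eq_bigr do rewrite (exchange_big_dep xpredT) //=.
rewrite (exchange_big_dep xpredT) //=; apply: eq_bigr => a _.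
have [e [P [e0 es Pe Pa]]] := irreducible_root_exists j card_E s_gt0 a.
have es' : (e < s.+1)%N by rewrite ltnS dvdn_leq.
have PU e' P' : P' \in irreds k e' -> root (map_poly j P') a -> P' = P.
  move: Pe; rewrite !mem_irreds => /and3P[/irreducibleP Pi Pm _].
  move=> /and3P[/irreducibleP Pi' Pm' _] Pa'.
  apply/eqP/negPn/negP => nPP'; have : coprimep (map_poly j P') (map_poly j P).
    rewrite coprimep_map irreducible_poly_coprime //; apply: contra nPP' => PP'.
    by rewrite -eqp_monic //; apply: Pi.2 => //; rewrite neq_ltn Pi'.1 orbT.
  by move/coprimep_root => /(_ _ Pa'); rewrite -rootE Pa.
rewrite big_mkcond (bigD1_seq e) ?iota_uniq ?mem_index_iota ?e0 //= es.
rewrite big_mkcond (bigD1_seq P) ?irreds_uniq //= Pa big1_seq ?addr0; last first.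
  move=> P' /andP[nP' P'e]; case: ifP => // Pa'.
  by rewrite (PU _ _ P'e Pa') eqxx in nP'.
rewrite big1_seq ?addr0 // => e' /andP[ne' _]; case: ifP => // e's.
rewrite big_seq_cond big1 // => P' /andP[P'e Pa'].
have P'P := PU _ _ P'e Pa'; move: P'e Pe ne'; rewrite P'P !mem_irreds.
by move=> /and3P[_ _ /eqP->] /and3P[_ _ /eqP[->]]; rewrite eqxx.
Qed.

End LambdaSum.

(** * Kummer sums and the bound of Katz *)

Lemma sum_prim_root (C : idomainType) D (zeta : C) :
  (1 < D)%N -> D.-primitive_root zeta -> \sum_(j < D) zeta ^+ j = 0.
Proof.
move=> D1 zp; apply/eqP; have := subrX1 zeta D.
rewrite (prim_expr_order zp) subrr => /esym/eqP; rewrite mulf_eq0 subr_eq0.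
case/orP => // /eqP z1.
have := prim_order_dvd zp 1; rewrite expr1 z1 eqxx dvdn1 => /eqP D_1.
by rewrite D_1 in D1.
Qed.

(* Upper bounds on all classes give a bound on the character sum, because the
   values of the character sum to zero and the class sizes have a known total. *)
Lemma balanced_sum_bound (C : numDomainType) D (zeta : C) (n : 'I_D -> nat) T :
  (1 < D)%N -> D.-primitive_root zeta -> (forall j, D * n j <= T)%N ->
  D%:R * `|\sum_(j < D) zeta ^+ j *+ n j| <= (D * T - D * \sum_(j < D) n j)%:R.
Proof.
move=> D1 zp nT.
have z1 : `|zeta| = 1.
  apply/eqP; rewrite -(pexpr_eq1 (ltnW D1)) ?normr_ge0 //.
  by rewrite -normrX (prim_expr_order zp) normr1.
have -> : D%:R * `|\sum_(j < D) zeta ^+ j *+ n j| =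
    `|\sum_(j < D) zeta ^+ j *+ (T - D * n j)|.
  rewrite -normr_nat -normrM -normrN; congr `|_|.
  under [RHS]eq_bigr => j _ do rewrite mulrnBr //.
  rewrite sumrB sumrMnl sum_prim_root // mul0rn sub0r mulr_sumr; congr (- _).
  by apply: eq_bigr => j _; rewrite mulr_natl -mulrnA mulnC.
apply: (le_trans (ler_norm_sum _ _ _)).
rewrite (eq_bigr (fun j => (T - D * n j)%:R)); last first.
  by move=> j _; rewrite normrMn normrX z1 expr1n.
by rewrite -natr_sum sumnB // sum_nat_const card_ord big_distrr.
Qed.

Section KummerBound.
Variables (C : numDomainType) (E : finFieldType) (q m r : nat) (V : E).
Variables (N D t : nat) (zeta : C) (gamma : E).
Let w := (q ^ (m * r))%N.
Let M := (\sum_(l < m) q ^ l)%N.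
Hypotheses (q_nat : [pchar E].-nat q) (q_gt1 : (1 < q)%N) (card_E : #|E| = (w ^ 2)%N).
Hypotheses (m_gt0 : (0 < m)%N) (r_gt0 : (0 < r)%N).
Hypotheses (V_fix : V ^+ (q ^ m) = V).
Hypothesis V_gen : forall l, (0 < l < m)%N -> V ^+ (q ^ l) != V.
Hypotheses (D_gt1 : (1 < D)%N) (DM : (D %| M)%N) (DN : (D * N = (q ^ m).-1)%N).
Hypotheses (wt : w = (D * t).+1) (t_large : (2 * M.-1 + 4 <= t)%N).
Hypotheses (zeta_prim : D.-primitive_root zeta) (gamma_prim : D.-primitive_root gamma).

(** Since [V ^+ (q ^ m) = V], [H a] is the product of the [V - a ^+ (q ^ l)] over [l < m]. The
    substitution [a = V - 1/u] sends the root [V] to infinity and turns [H a] into [u ^- M * f.[u]].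
    The factor [l = 0] of [f] is constant, so [f] has degree [M - 1], which is coprime to [D] as
    Stepanov's method requires. *)
Let H (a : E) := \prod_(l < m) (V ^+ (q ^ (m - l)) - a) ^+ (q ^ l).
Let f : {poly E} :=
  \prod_(l < m) (1 + (V ^+ (q ^ (m - l)) - V) *: 'X) ^+ (q ^ l).
Let X (a : E) := powchar N D zeta gamma (\prod_(l < m * (2 * r)) (V - a ^+ (q ^ l))).
Let Y (u : E) := \sum_(j < D) zeta ^+ j *+ (f.[u] ^+ (t * w.+1) == gamma ^+ j).

Let M_gt0 : (0 < M)%N.
Proof. by rewrite /M; case: (m) m_gt0 => // m' _; rewrite big_ord_recl. Qed.

Let V_period n : V ^+ (q ^ (m * n)) = V.
Proof. by elim: n => [|n IH]; rewrite ?muln0 ?expr1 // mulnS expnD exprM V_fix. Qed.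

Let prod_H (a : E) n : \prod_(l < m * n) (V - a ^+ (q ^ l)) =
  H a ^+ (\sum_(l < n) q ^ (m * l)).
Proof.
elim: n => [|n IH]; first by rewrite muln0 !big_ord0.
rewrite mulnSr big_split_ord IH big_ord_recr /= exprD; congr (_ * _).
rewrite /H -prodrXl; apply: eq_bigr => l _.
rewrite -exprM -expnD exprBn_pchar ?pnatX ?q_nat // -exprM -expnD [(m * n + l)%N]addnC.
by rewrite addnA subnK ?(ltnW (ltn_ord l)) // -mulnS V_period.
Qed.

(** Both sides are [(w ^ 2 - 1) / D]: the geometric sum is [(w ^ 2 - 1) / (q ^ m - 1)] and [N] is
    [(q ^ m - 1) / D]. *)
Let expE : ((\sum_(l < 2 * r) q ^ (m * l)) * N = t * w.+1)%N.
Proof.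
apply/eqP; rewrite -(eqn_pmul2l (ltnW D_gt1)) mulnCA DN mulnC.
under eq_bigr do rewrite expnM.
rewrite -predn_exp mulnA -expnM [(2 * r)%N]mulnC mulnA expnM -/w.
rewrite (_ : D * t = w.-1)%N; last by rewrite wt.
by rewrite wt; apply/eqP; lia.
Qed.

Let H_inv (u : E) : u != 0 -> H (V - u^-1) = u ^- M * f.[u].
Proof.
move=> u0; rewrite horner_prod /M -[u ^- _]exprVn expr_sum /H -big_split.
apply: eq_bigr => l _ /=; rewrite horner_exp -exprMn; congr (_ ^+ _).
by rewrite !hornerE; field.
Qed.

Let w2_gt0 : (0 < w ^ 2)%N. Proof. by rewrite expn_gt0 wt. Qed.

Let expQ : (D * (t * w.+1) = (w ^ 2).-1)%N. Proof. by rewrite wt; lia. Qed.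

(** As [D] divides [M], the factor [u ^- M] is a [D]-th power, invisible to the character. *)
Let uM (u : E) : u != 0 -> u ^+ (M * (t * w.+1)) = 1.
Proof.
move=> u0; have uQ : u ^+ (w ^ 2).-1 = 1.
  apply: (mulfI u0); rewrite mulr1 -exprS prednK ?w2_gt0 //.
  by rewrite -card_E expf_card.
have [M' ->] := dvdnP DM.
by rewrite -mulnA mulnC exprM expQ uQ expr1n.
Qed.

Let X_Y (u : E) : u != 0 -> X (V - u^-1) = Y u.
Proof.
move=> u0; apply: eq_bigr => j _; rewrite prod_H -exprM expE H_inv // exprMn.
by rewrite -exprVn -exprM exprVn uM // invr1 mul1r.
Qed.

Let X_V : X V = 0.
Proof.
have l0 : (0 < m * (2 * r))%N by rewrite !muln_gt0 m_gt0 r_gt0.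
have N0 : (0 < N)%N.
  have : (0 < (q ^ m).-1)%N.
    by rewrite -ltnS prednK ?expn_gt0 ?(ltnW q_gt1) // -(expn0 q) ltn_exp2l.
  by rewrite -DN muln_gt0 => /andP[].
rewrite /X (bigD1 (Ordinal l0)) //= expr1 subrr mul0r /powchar big1 // => j _.
by rewrite expr0n gtn_eqF // eq_sym expf_eq0 (negPf (prim_root_neq0 gamma_prim)) andbF.
Qed.

Let f0 : f.[0] = 1.
Proof.
by rewrite horner_prod big1 // => l _; rewrite horner_exp !hornerE expr1n.
Qed.

Let Y0 : Y 0 = 1.
Proof.
rewrite /Y f0 expr1n (bigD1 (Ordinal (ltnW D_gt1))) //= eqxx big1 ?addr0 // => j j0.
rewrite eq_sym -(prim_order_dvd gamma_prim) gtnNdvd // lt0n.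
by move: j0; rewrite -val_eqE.
Qed.

Let size_f : size f = M.-1.+1.
Proof.
have sz (l : 'I_m) : size ((1 + (V ^+ (q ^ (m - l)) - V) *: 'X) ^+ (q ^ l) : {poly E}) =
    ((l != 0 :> nat) * q ^ l).+1.
  have [l0|l0] := eqVneq (l : nat) 0%N.
    by rewrite l0 subn0 V_fix subrr scale0r addr0 expr1n size_poly1.
  have Vl : V ^+ (q ^ (m - l)) - V != 0.
    by rewrite subr_eq0 V_gen // subn_gt0 ltn_ord -subn_gt0 subKn ?lt0n // ltnW.
  have s2 : size (1 + (V ^+ (q ^ (m - l)) - V) *: 'X) = 2.
    by rewrite addrC size_polyDl size_scale ?size_polyX ?size_poly1.
  rewrite -[LHS]prednK ?size_exp ?s2 ?mul1n // size_poly_gt0 expf_neq0 //.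
  by rewrite -size_poly_eq0 s2.
rewrite size_prod; last by move=> l _; rewrite -size_poly_eq0 sz.
rewrite (eq_bigr _ (fun l _ => sz l)).
under eq_bigr do rewrite -addn1.
rewrite big_split sum_nat_const card_ord muln1 -addSn addnK prednK // /M.
case: (m) m_gt0 => // m' _; rewrite !big_ord_recl /= mul0n add0n add1n.
by congr _.+1; apply: eq_bigr => l _; rewrite mul1n.
Qed.

(** As [0^-1 = 0], the bijection [u -> V - u^-1] sends 0 to [V], where [X] vanishes whereas
    [Y 0 = 1]: hence the correction. *)
Let sum_X : \sum_a X a = \sum_u Y u - 1.
Proof.
rewrite (reindex_inj (h := fun u => V - u^-1)); last first.
  by move=> u u' /addrI/oppr_inj/invr_inj.
rewrite (bigD1 0) //= invr0 subr0 X_V add0r [in RHS](bigD1 0) //= Y0.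
by rewrite [1 + _]addrC addrK; apply: eq_bigr => u u0; rewrite X_Y.
Qed.

Let n (j : 'I_D) := #|[set u | (f.[u] != 0)%R & f.[u] ^+ (t * w.+1) == gamma ^+ j]|.

Let e_gt0 : (0 < t * w.+1)%N.
Proof. by rewrite muln_gt0 andbT (leq_trans _ t_large) // addn4. Qed.

Let sum_Y : \sum_u Y u = \sum_(j < D) zeta ^+ j *+ n j.
Proof.
rewrite /Y exchange_big; apply: eq_bigr => j _ /=.
rewrite sumrMnr; congr (_ *+ _); rewrite /n -sum1_card [in RHS]big_mkcond.
apply: eq_bigr => u _; rewrite inE; case: (eqVneq f.[u] 0) => [->|_] /=; last by case: eqP.
rewrite expr0n gtn_eqF // eq_sym expf_eq0.
by rewrite (negPf (prim_root_neq0 gamma_prim)) andbF.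
Qed.

(** When [f.[u]] is nonzero, its power [t * w.+1] is a [D]-th root of unity, which puts [u] in some
    class; [f] has at most [M.-1] roots. *)
Let sum_n : (w ^ 2 <= \sum_(j < D) n j + M.-1)%N.
Proof.
have f_neq0 : f != 0 by rewrite -size_poly_eq0 size_f.
rewrite -card_E -(cardC (fun u => f.[u] == 0)) addnC leq_add //.
  under [X in (_ <= X)%N]eq_bigr do rewrite /n -sum1_card.
  rewrite (exchange_big_dep xpredT) //= -sum1_card big_mkcond leq_sum // => u _.
  case: ifP => // fu; have fu0 : f.[u] != 0 by [].
  have : (f.[u] ^+ (t * w.+1)) ^+ D = 1.
    rewrite -exprM mulnC expQ.
    apply: (mulfI fu0); rewrite mulr1 -exprS prednK ?w2_gt0 //.
    by rewrite -card_E expf_card.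
  case/(prim_rootP gamma_prim) => j fj.
  by rewrite (bigD1 j) //= inE fu0 fj eqxx.
rewrite -ltnS -size_f cardE; apply: max_poly_roots => //; last exact: enum_uniq.
by apply/allP => u; rewrite mem_enum.
Qed.

Lemma kummer_bound :
  `|\sum_a X a| <= (1 + D * M.-1 + D * (2 * M.-1 + 2) + M.-1 + 1)%:R * w%:R.
Proof.
set B := M.-1; set c := (1 + D * B + D * (2 * B + 2))%N.
have nT j : (D * n j <= w ^ 2 + c * w)%N.
  apply: stepanov_bound => //.
  - by rewrite /w pnatX q_nat.
  - by apply: coprime_dvdr DM _; rewrite coprimePn.
have := balanced_sum_bound D_gt1 zeta_prim nT; rewrite -sum_Y => SY.
have {}SY : `|\sum_u Y u| <= (c * w + B)%:R.
  have D0 : (0 : C) < D%:R by rewrite ltr0n ltnW.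
  rewrite -(ler_pM2l D0) (le_trans SY) // -natrM ler_nat -mulnBr leq_mul2l.
  have := sum_n; rewrite -/B.
  by move: (\sum_(j < D) n j)%N (w ^ 2)%N (c * w)%N => x y z; lia.
rewrite sum_X (le_trans (ler_normB _ _)) // normr1.
have w0 : (0 < w)%N by rewrite wt.
rewrite (le_trans (lerD SY (lexx 1))) // -natrM -(natrD _ _ 1) ler_nat.
have : (B * 1 <= B * w)%N by rewrite leq_mul.
by rewrite -/c !mulnDl; lia.
Qed.

End KummerBound.

(** As [h ^+ M], with [M] the sum of the [#|k| ^ l], generates the image of the nonzero elements of
    [k], the divisibility of [M] by [D] says that the character is trivial on them. *)
Theorem katz_bound (C : numClosedFieldType) (k K : finFieldType)
    (i : {rmorphism k -> K}) (m N D : nat) (v h : K) (zeta : C) :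
  (forall x : C, exists n : nat, `|x| < n%:R) ->
  #|K| = (#|k| ^ m)%N ->
  (forall l, (0 < l < m)%N -> v ^+ (#|k| ^ l) != v) ->
  (1 < D)%N -> (D %| \sum_(l < m) #|k| ^ l)%N -> (#|K|.-1 = D * N)%N ->
  (#|K|.-1).-primitive_root h -> D.-primitive_root zeta ->
  `|\sum_(a : k) powchar N D zeta (h ^+ N) (v + i a)| <=
    (m - 1)%:R * sqrtC #|k|%:R.
Proof.
move=> arch card_K v_gen D1 DM DN hp zp; set q := #|k| in card_K v_gen DM *.
set chi := powchar N D zeta (h ^+ N); set M := (\sum_(l < m) q ^ l)%N in DM.
have q1 : (1 < q)%N by apply: card_finNzRing_gt1.
have K1 : (1 < #|K|)%N by apply: card_finNzRing_gt1.
have m0 : (0 < m)%N by move: K1; rewrite card_K; case: (m).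
pose phi g := chi (ev i v g).
have phi1 : phi 1 = 1 by rewrite /phi /ev rmorph1 hornerE /chi powchar1.
have phiM g1 g2 : phi (g1 * g2) = phi g1 * phi g2.
  by rewrite /phi /ev rmorphM hornerM /chi powcharM.
have c1 : lcoef phi 1 = \sum_(a : k) chi (v + i a).
  rewrite /lcoef big_map big_enum /=.
  have b : bijective (fun a : k => const_mx a : 'rV[k]_1).
    exists (fun u : 'rV[k]_1 => u 0 0) => [a|u]; first by rewrite mxE.
    by apply/rowP => l; rewrite mxE !ord1.
  rewrite (reindex _ (onW_bij _ b)); apply: eq_bigr => a _ /=; rewrite /phi /ev.
  have -> : rVpoly (const_mx a : 'rV[k]_1) = a%:P.
    apply/polyP => -[|l]; rewrite coefC coef_rVpoly; case: insubP => //=.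
    by move=> u _ _; rewrite mxE.
  by rewrite rmorphD /= map_polyX map_polyC !hornerE.
rewrite -c1.
have DNq : (D * N = (q ^ m).-1)%N by rewrite -DN card_K.
have DK : (D %| #|K|.-1)%N by rewrite DN dvdn_mulr.
have gp : D.-primitive_root (h ^+ N).
  by have := dvdn_prim_root hp DK; rewrite DN mulKn // ltnW.
pose B := M.-1.
(* For [r] past this threshold, [w = q ^ (m * r) > r] makes [(w - 1) / D] at least [2 * B + 4], as
   Stepanov's method needs. *)
apply: (@lcoef1_bound _ arch (lcoef phi) (lambda phi) m q (D * (2 * B + 4)).+1
  (1 + D * B + D * (2 * B + 2) + B + 1)%:R).
- exact: ltnW.
- exact: lcoef0.
- move=> n mn; apply: (@sum_ev_monics _ _ i m v card_K v_gen _ chi n mn).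
  exact: powchar_sum.
- exact: lcoef_lambda.
move=> r r0; have r1 : (0 < r)%N by apply: leq_trans r0.
have [|E [i' card_E]] := @finite_extension K (2 * r)%N; first by rewrite muln_gt0.
have card_E' : #|E| = (q ^ (m * (2 * r)))%N by rewrite card_E card_K -expnM.
have s0 : (0 < m * (2 * r))%N by rewrite !muln_gt0 m0 r1.
rewrite [(2 * m)%N]mulnC -mulnA (lambda_sum i i' v card_E' s0 DN D1 hp zp).
have Dw : (D %| (q ^ (m * r)).-1)%N.
  by rewrite expnM predn_exp dvdn_mulr // -DNq dvdn_mulr.
have w0 : (0 < q ^ (m * r))%N by rewrite expn_gt0 (ltnW q1).
rewrite -natrX -expnM.
apply: (@kummer_bound _ E q m r (i' v) N D ((q ^ (m * r)).-1 %/ D)) => //.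
- exact: (pchar_nat_base (i' \o i : {rmorphism k -> E})).
- by rewrite card_E' mulnC -mulnA mulnC expnM mulnC.
- by rewrite -rmorphXn -card_K expf_card.
- by move=> l lm; rewrite -rmorphXn (inj_eq (fmorph_inj i')) v_gen.
- by rewrite [(D * _)%N]mulnC divnK // prednK.
- rewrite leq_divRL ?(ltnW D1) // -ltnS prednK // mulnC.
  rewrite (leq_trans r0) // (leq_trans (ltnW (ltn_expl r q1))) // leq_exp2l //.
  by rewrite leq_pmull.
- by rewrite fmorph_primitive_root.
Qed.

(** * The half circle *)

Section Trigo.
Variable R : realType.
Implicit Type x y : R.

Lemma ler_cos x y : 0 <= x -> x <= y -> y <= pi -> cos y <= cos x.
Proof.
move=> x0 xy yp; rewrite leNgt; apply/negP; rewrite ltr_cos ?in_itv /=.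
- by rewrite ltNge xy.
- by rewrite yp (le_trans x0).
- by rewrite x0 (le_trans xy).
Qed.

Lemma sin_le_id y : 0 <= y -> sin y <= y.
Proof.
move=> y0; have [c _] := @MVT_segment R sin cos 0 y y0 (fun z _ => @is_derive_sin R z)
  (derivable_within_continuous (fun z _ => @derivable_sin R z)).
rewrite sin0 !subr0 => ->; rewrite -[X in _ <= X]mul1r.
by rewrite ler_wpM2r // cos_le1.
Qed.

Lemma mul_cos_le_sin y : 0 <= y <= pi -> y * cos y <= sin y.
Proof.
move=> /andP[y0 yp]; rewrite -subr_ge0.
pose f : R -> R := fun z => sin z - z * cos z.
have df (z : R) : is_derive z 1 f (z * sin z).
  have H : is_derive z 1 ((@sin R : R -> R) - ((id : R -> R) * (@cos R : R -> R)))
      (cos z - (z *: - sin z + cos z *: 1)) by apply: is_deriveB.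
  apply: (is_derive_eq H); rewrite /GRing.scale /=; ring.
have [c] := @MVT_segment R f (fun z => z * sin z) 0 y y0 (fun z _ => df z)
  (derivable_within_continuous (fun z _ => @ex_derive _ _ _ _ _ _ _ (df z))).
rewrite in_itv /= => /andP[c0 cy].
rewrite /f mul0r sin0 subrr !subr0 => ->.
by rewrite !mulr_ge0 // sin_ge0_pi // c0 (le_trans cy).
Qed.

(** With [y = x / 2], [sin x = 2 sin y cos y >= 2 y cos^2 y = 2 y (1 - sin^2 y) >= 2 y (1 -
    y^2)]. *)
Lemma sin_lower x : 0 <= x <= pi -> x * (1 - x ^+ 2 / 4) <= sin x.
Proof.
move=> /andP[x0 xp].
pose y := x / 2; have y0 : 0 <= y by rewrite divr_ge0.
have yp : y <= pi by rewrite /y; lra.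
have -> : x = y *+ 2 by rewrite /y -mulr_natr; field.
have cy : 0 <= cos y.
  have p0 := pi_ge0 R.
  by apply: cos_ge0_pihalf; apply/andP; split; rewrite /y; lra.
have sy : 0 <= sin y by apply: sin_ge0_pi; rewrite y0.
have s1 : y * cos y <= sin y by apply: mul_cos_le_sin; rewrite y0.
have s2 := sin_le_id y0; have cs := cos2Dsin2 y.
have -> : y *+ 2 * (1 - (y *+ 2) ^+ 2 / 4) = y * (1 - y ^+ 2) *+ 2.
  by rewrite !mulr2n; field.
rewrite sin_mulr2n lerMn2r /=.
have : y * cos y * cos y <= sin y * cos y by apply: ler_wpM2r.
have : y * sin y ^+ 2 <= y * y ^+ 2 by rewrite ler_wpM2l // lerXn2r.
have -> : y * cos y * cos y = y * (1 - sin y ^+ 2) by rewrite -cs; ring.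
by rewrite !mulrBr !mulr1 [sin y * cos y]mulrC; lra.
Qed.

(** At [x = pi / d], [sin_lower] reduces the claim to [pi ^ 2 <= 4 d], which follows from
    [pi < 4 <= d]. *)
Lemma sin_pi_div d : (4 <= d)%N ->
  pi / d%:R * ((d%:R - 1) / d%:R) <= sin (pi / d%:R) :> R.
Proof.
move=> d4; have d4R : (4 : R) <= d%:R by rewrite ler_nat.
have p0 := pi_gt0 R; have p4 : pi < 4 :> R by have := pihalf_lt2 R; lra.
have d0 : (0 : R) < d%:R by lra.
apply: le_trans (sin_lower _); last first.
  apply/andP; split; first by rewrite divr_ge0 ?ltW.
  by rewrite ler_pdivrMr //; nra.
rewrite ler_wpM2l ?divr_ge0 ?(ltW p0) ?(ltW d0) // -subr_ge0.
have -> : 1 - (pi / d%:R) ^+ 2 / 4 - (d%:R - 1) / d%:R =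
    (4 * d%:R - pi ^+ 2) / (4 * d%:R ^+ 2) :> R.
  by field; rewrite gt_eqF.
by rewrite divr_ge0 ?mulr_ge0 ?exprn_ge0 ?ltW //; nra.
Qed.

Definition cis x : R[i] := (cos x +i* sin x)%C.

Lemma cisD x y : cis (x + y) = cis x * cis y.
Proof.
by rewrite /cis cosD sinD /GRing.mul /= [cos x * sin y + _]addrC.
Qed.

Lemma cis0 : cis 0 = 1. Proof. by rewrite /cis cos0 sin0. Qed.

Lemma cisX x n : cis x ^+ n = cis (x *+ n).
Proof.
by elim: n => [|n IH]; rewrite ?expr0 ?mulr0n ?cis0 // exprS IH mulrS cisD.
Qed.

Definition unity_root d := cis (pi *+ 2 / d%:R).

Lemma unity_root_prim d : (0 < d)%N -> d.-primitive_root (unity_root d).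
Proof.
move=> d0; have dR : (0 : R) < d%:R by rewrite ltr0n.
have wd : unity_root d ^+ d = 1.
  by rewrite cisX -[_ *+ d]mulr_natr divfK ?gt_eqF // /cis cos2pi sin2pi.
have [m mp /dvdn_leq md] := prim_order_exists d0 wd.
suff e : m = d by rewrite e in mp.
apply/eqP; rewrite eqn_leq md // leqNgt; apply/negP => lt_md.
have m0 := prim_order_gt0 mp; have mR : (0 : R) < m%:R by rewrite ltr0n.
have := prim_expr_order mp; rewrite cisX /cis => -[+ _].
pose y : R := pi * m%:R / d%:R.
have -> : pi *+ 2 / d%:R *+ m = y *+ 2.
  by rewrite /y -[_ *+ m]mulr_natr !mulr2n; ring.
rewrite cos_mulr2n cos2sin2 => e.
have : 0 < sin y.
  apply: sin_gt0_pi; rewrite /y !mulr_gt0 ?pi_gt0 ?invr_gt0 //=.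
  by rewrite ltr_pdivrMr // ltr_pM2l ?pi_gt0 // ltr_nat.
have : sin y ^+ 2 = 0 by move: e; rewrite mulr2n; lra.
by move/eqP; rewrite sqrf_eq0 => /eqP->; rewrite ltxx.
Qed.

(* All the summands lie within an angle [pi / 2 - pi / d] of the bisector of
   the half circle. *)
Lemma half_circle_sum (T : finType) d (e : T -> nat) :
  (4 <= d)%N -> ~~ odd d -> (forall a, e a < d./2)%N ->
  ((#|T|%:R * sin (pi / d%:R)) ^+ 2)%:C%C <=
    `|\sum_a unity_root d ^+ e a| ^+ 2.
Proof.
move=> d4 dodd ed; set S := \sum_a _; rewrite -add_Re2_Im2 lecR.
pose h := d./2; have dh : d = (2 * h)%N by rewrite -[LHS]odd_double_half (negPf dodd) mul2n.
have h2 : (2 <= h)%N by lia.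
have hR : (2 : R) <= h%:R by rewrite ler_nat.
have h0 : (0 : R) < h%:R by lra.
have dR : d%:R = 2 * h%:R :> R by rewrite dh natrM.
have p0 := pi_gt0 R.
(* The middle of the angles [2 pi j / d] for [0 <= j <= h - 1], where [d = 2 h]. *)
pose phi : R := pi * (h%:R - 1) / (2 * h%:R).
pose al a : R := pi *+ 2 / d%:R *+ e a.
have ReS : complex.Re S = \sum_a cos (al a).
  rewrite /S (big_morph (@complex.Re R) (id1 := 0) (op1 := +%R)) //=; last by case=> ? ? [].
  by apply: eq_bigr => a _; rewrite cisX.
have ImS : complex.Im S = \sum_a sin (al a).
  rewrite /S (big_morph (@complex.Im R) (id1 := 0) (op1 := +%R)) //=; last by case=> ? ? [].
  by apply: eq_bigr => a _; rewrite cisX.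
have low a : sin (pi / d%:R) <= cos (al a - phi).
  rewrite -cosBpihalf -cosN -[X in _ <= X]cos_norm.
  have ea : (e a)%:R <= h%:R - 1 :> R.
    by rewrite lerBrDr natr1 ler_nat ed.
  have ea0 : 0 <= (e a)%:R :> R by [].
  have -> : al a - phi = pi * (2 * (e a)%:R - h%:R + 1) / (2 * h%:R).
    by rewrite /al /phi dR -[_ *+ e a]mulr_natr mulr2n; field; rewrite gt_eqF.
  have -> : - (pi / d%:R - pi / 2) = pi * (h%:R - 1) / (2 * h%:R) :> R.
    by rewrite dR; field; rewrite gt_eqF.
  have h20 : 0 < 2 * h%:R :> R by rewrite mulr_gt0.
  apply: ler_cos => //.
    rewrite normrM (gtr0_norm (x := (2 * h%:R)^-1)) ?invr_gt0 //.
    rewrite ler_pM2r ?invr_gt0 // normrM gtr0_norm // ler_pM2l //.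
    by rewrite ler_norml; apply/andP; split; lra.
  rewrite ler_pdivrMr //; nra.
have key : #|T|%:R * sin (pi / d%:R) <= cos phi * complex.Re S + sin phi * complex.Im S.
  rewrite ReS ImS !mulr_sumr -big_split /= mulr_natl -sumr_const ler_sum // => a _.
  by rewrite (le_trans (low a)) // cosB mulrC [sin _ * sin _]mulrC.
have sin0 : 0 <= sin (pi / d%:R) :> R.
  apply: sin_ge0_pi; rewrite dR; apply/andP; split.
    by apply: divr_ge0; lra.
  by rewrite ler_pdivrMr; nra.
have q0 : 0 <= #|T|%:R * sin (pi / d%:R) :> R by rewrite mulr_ge0.
(* The projection of [S] on the direction [phi] bounds [|S|] from below: the difference of the
   squares is the square of the orthogonal component. *)
apply: (@le_trans _ _ ((cos phi * complex.Re S + sin phi * complex.Im S) ^+ 2)).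
  by rewrite lerXn2r // nnegrE // (le_trans q0).
rewrite -subr_ge0.
rewrite [X in 0 <= X](_ : _ = (cos phi * complex.Im S - sin phi * complex.Re S) ^+ 2).
  exact: sqr_ge0.
rewrite -[X in X - _]mul1r -(cos2Dsin2 phi); ring.
Qed.

Lemma complex_arch (z : R[i]) : exists n : nat, `|z| < n%:R.
Proof.
rewrite normc_def; set r := Num.sqrt _.
exists (Num.truncn r).+1; rewrite -(rmorph_nat (real_complex R)) ltcR.
exact: truncnS_gt.
Qed.

End Trigo.

(** * Peisert graphs *)

Section PeisertSet.
Variables (F : finFieldType) (g : F) (d : nat).
Hypotheses (g_prim : is_primitive_root g) (d_gt1 : (1 < d)%N).
Hypothesis dF : (d %| #|F|.-1)%N.

(** Raising to the power [N] makes [g] an element of order [d] and erases the multiple [d * k] in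
    the exponent, leaving [e] congruent to [j] modulo [d]. *)
Lemma peisert_set_exp e : g ^+ e \in peisert_set g d -> (e %% d < d./2)%N.
Proof.
rewrite inE => /asboolP[k [j [jd ge]]].
pose N := (#|F|.-1 %/ d)%N.
have g0 : g != 0 := primitive_root_neq0 g_prim.
have gp : d.-primitive_root (g ^+ N) := dvdn_prim_root g_prim dF.
have : (g ^+ N) ^+ e = (g ^+ N) ^+ j.
  rewrite -!exprM mulnC [(N * j)%N]mulnC !exprM ge expfzDr // exprMn.
  rewrite -exprnP -[RHS]mul1r; congr (_ * _).
  rewrite exprnP exprz_exp mulrAC -exprz_exp -PoszM -exprnP mulnC divnK //.
  by rewrite (prim_expr_order g_prim) exp1rz.
move/eqP; rewrite (eq_prim_root_expr gp) => /eqP->.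
by rewrite modn_small; lia.
Qed.

Lemma peisert_set_dvd e : (d %| e)%N -> g ^+ e \in peisert_set g d.
Proof.
move=> /dvdnP[c ->]; rewrite inE; apply/asboolP; exists c%:Z, 0%N; split=> //.
by rewrite addr0 -PoszM -exprnP mulnC.
Qed.

(* The multiples of [e] avoid the upper half of the residues mod [d] only if
   they all vanish, as [- e] is one of them. *)
Lemma peisert_set_subgroup e :
  (forall c, g ^+ (e * c) \in peisert_set g d) -> (d %| e)%N.
Proof.
move=> ge; have := peisert_set_exp (ge 1%N); have := peisert_set_exp (ge d.-1).
rewrite muln1 -modnMml /dvdn; have := ltn_pmod e (ltnW d_gt1).
move: (e %% d)%N => o od; case: o od => // o od.
have -> : (o.+1 * d.-1 = o * d + (d - o.+1))%N by nia.
by rewrite modnMDl modn_small; lia.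
Qed.

End PeisertSet.

Lemma dvdn_pred_exp q m n : (m %| n)%N -> ((q ^ m).-1 %| (q ^ n).-1)%N.
Proof.
by case/dvdnP=> c ->; rewrite mulnC expnM [X in (_ %| X)%N]predn_exp dvdn_mulr.
Qed.

(** The set consists of roots of ['X^Q - 'X], hence the upper bound; conversely, it is a field
    containing a power of [g] of order [Q - 1]. *)
Lemma card_frobenius_fixed (F : finFieldType) (g : F) q m n :
  is_primitive_root g -> [pchar F].-nat q -> (1 < q)%N -> (0 < m)%N ->
  #|F| = (q ^ n)%N -> (m %| n)%N ->
  #|[set x : F | x ^+ (q ^ m) == x]| = (q ^ m)%N.
Proof.
move=> gp qF q1 m0 card_F mn; set S := [set x | _]; set Q := (q ^ m)%N.
have Q1 : (1 < Q)%N by rewrite -(expn0 q) ltn_exp2l.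
apply/eqP; rewrite eqn_leq; apply/andP; split.
  have sQ : size ('X^Q - 'X : {poly F}) = Q.+1.
    by rewrite size_polyDl size_polyXn // size_polyN size_polyX.
  rewrite -ltnS -sQ cardE; apply: max_poly_roots; rewrite ?enum_uniq //.
    by rewrite -size_poly_eq0 sQ.
  by apply/allP => x; rewrite mem_enum inE rootE !hornerE subr_eq0.
have QF : [pchar F].-nat Q by rewrite pnatX qF.
have [K [i [Si card_K]]] := subfield_typeP (frobenius_fixed_subfield QF).
have glp : (Q.-1).-primitive_root (g ^+ (#|F|.-1 %/ Q.-1)).
  by apply: dvdn_prim_root; rewrite // card_F dvdn_pred_exp.
have /codomP[h hE] : g ^+ (#|F|.-1 %/ Q.-1) \in codom i.
  rewrite -Si inE -[X in _ ^+ X](prednK (ltnW Q1)).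
  by rewrite exprS (prim_expr_order glp) mulr1.
have K1 := card_finNzRing_gt1 K.
have : (Q.-1 %| #|K|.-1)%N.
  rewrite (prim_order_dvd glp) hE -rmorphXn fmorph_eq1.
  have h0 : h != 0.
    by rewrite -(fmorph_eq0 i) -hE; apply: prim_root_neq0 glp.
  by apply/eqP/(mulfI h0); rewrite mulr1 -exprS prednK ?expf_card // ltnW.
rewrite -[#|S|]card_K; move: #|K| K1 => c c1 /dvdn_leq H.
by have {}H : (Q.-1 <= c.-1)%N by [apply: H; lia]; lia.
Qed.

Theorem theorem1p4 (R : realType) (d n p k q : nat) (F : finFieldType) (g : F)
    (Fq : {set F})
    (d_ge4 : (4 <= d)%N) (d_even : ~~ odd d) (n_ge1 : (1 <= n)%N)
    (p_prime : prime p) (p_odd : odd p)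
    (k_gt0 : (0 < k)%N) (q_def : q = (p ^ k)%N)
    (q_mod : (q ^ n)%N = 1%N %[mod 2 * d])
    (q_large : (n%:R - 1) ^+ 2 * d%:R ^+ 4 / (pi ^+ 2 * (d%:R - 1) ^+ 2)
               < q%:R :> R)
    (card_F : #|F| = (q ^ n)%N) (g_prim : is_primitive_root g)
    (Fq_subfield : is_subfield Fq) (card_Fq : #|Fq| = q) :
  is_maximal_subfield_clique (peisert_graph g d) Fq ->
  is_maximal_clique (peisert_graph g d) Fq.
Proof.
move=> [[_ Fq_clique] Fq_max]; split=> // -[Q [Q_clique /properP[FqQ [v vQ vFq]]]].
have dF : (d %| #|F|.-1)%N.
  rewrite card_F -subn1.
  move/eqP: q_mod; rewrite eqn_mod_dvd; first exact/dvdn_trans/dvdn_mull.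
  by rewrite -card_F ltnW // card_finNzRing_gt1.
have d1 : (1 < d)%N by lia.
have q1 : (1 < q)%N.
  by rewrite q_def -(expn0 p) ltn_exp2l // prime_gt1.
have v_peisert x : x \in Fq -> v - x \in peisert_set g d.
  move=> xF; apply: Q_clique => //; first exact: (fintype.subsetP FqQ).
  by apply: contraNneq vFq => ->.
have [kk [ik [Fq_ik card_k]]] := subfield_typeP Fq_subfield.
rewrite card_Fq in card_k.
have q_nat : [pchar F].-nat q by rewrite -card_k; exact: (pchar_nat_base ik).
(* [m] is the degree of [v] over [Fq], and [S] below is the subfield [Fq(v)]. *)
have [m mn [m0 vm v_gen]] := conjs_period card_F n_ge1 v.
have Sm : [pchar F].-nat (q ^ m)%N by rewrite pnatX q_nat.
pose S := [set x : F | x ^+ (q ^ m) == x].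
have S_sub : is_subfield S := frobenius_fixed_subfield Sm.
have card_S : #|S| = (q ^ m)%N :=
  card_frobenius_fixed g_prim q_nat q1 m0 card_F mn.
have [K [iK [S_iK card_K]]] := subfield_typeP S_sub; rewrite card_S in card_K.
have FqS x : x \in Fq -> x \in S.
  rewrite Fq_ik => /codomP[y ->].
  by rewrite inE -rmorphXn -card_k expf_cardX.
have [i iE] : exists i : {rmorphism kk -> K}, forall x, iK (i x) = ik x.
  apply: rmorphism_factor => x; have : ik x \in S by rewrite FqS // Fq_ik codom_f.
  by rewrite S_iK => /codomP[y ->]; exists y.
have /codomP[vK vE] : v \in codom iK by rewrite -S_iK inE vm.
(* The index of the nonzero elements of [S] in those of [F]: [g ^+ l] generates the former. *)
pose l := ((q ^ n).-1 %/ (q ^ m).-1)%N.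
have qmn : ((q ^ m).-1 %| (q ^ n).-1)%N by apply: dvdn_pred_exp.
have lE : (l * (q ^ m).-1 = (q ^ n).-1)%N by rewrite divnK.
have glp : ((q ^ m).-1).-primitive_root (g ^+ l).
  by apply: dvdn_prim_root; rewrite // -card_F.
have /codomP[h hE] : g ^+ l \in codom iK.
  rewrite -S_iK inE -[X in _ ^+ X]prednK ?expn_gt0 ?(ltnW q1) //.
  by rewrite exprS (prim_expr_order glp) mulr1.
have hp : (#|K|.-1).-primitive_root h.
  by rewrite card_K -(fmorph_primitive_root iK) -hE.
have S_gen x : x \in S -> x != 0 -> exists c, x = g ^+ (l * c).
  rewrite S_iK => /codomP[y ->]; rewrite fmorph_eq0 => /(prim_root_gen hp)[c ->].
  by exists c; rewrite rmorphXn /= -hE exprM.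
pose w := unity_root R d; have wp : d.-primitive_root w by apply: unity_root_prim; lia.
(* [w ^+ l] is the value at [g ^+ l] of the character sending [g] to [w], so its order [D] is that
   of the restriction to [S]. *)
have zd : (w ^+ l) ^+ d = 1 by rewrite exprAC (prim_expr_order wp) expr1n.
have [D zp Dd] := prim_order_exists (ltnW d1) zd.
(* If [D] were 1, then [d] would divide [l] and the nonzero elements of [S] would be [d]-th powers,
   making [S] a subfield clique larger than [Fq]. *)
have D1 : (1 < D)%N.
  rewrite ltn_neqAle (prim_order_gt0 zp) andbT; apply/eqP => D_1.
  have dl : (d %| l)%N.
    by rewrite (prim_order_dvd wp) -[w ^+ l]expr1 D_1 (prim_expr_order zp).
  apply: Fq_max; exists S; split; first split=> //.
    move=> x y xS yS xy; have [||c e] := S_gen (x - y).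
    - by case: S_sub => _ SB _; apply: SB.
    - by rewrite subr_eq0.
    by rewrite /peisert_graph /cayley e peisert_set_dvd // dvdn_mulr.
  apply/properP; split; first by apply/fintype.subsetP.
  by exists v; rewrite // inE vm.
pose M := (\sum_(c < m) q ^ c)%N.
have ME : ((q ^ m).-1 = q.-1 * M)%N by rewrite predn_exp.
(* The powers of [g ^+ (l * M)] lie in [Fq], hence in the connection set as [Fq] is a clique
   containing 0; [peisert_set_subgroup] then gives [d %| l * M]. *)
have DM : (D %| M)%N.
  rewrite (prim_order_dvd zp) -exprM -(prim_order_dvd wp).
  apply: (peisert_set_subgroup g_prim d1 dF) => c.
  have [y yE] : exists y, g ^+ (l * M * c) = ik y.
    apply: frob_fixed_in_base; rewrite card_k -[q in LHS](prednK (ltnW q1)) exprS.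
    have e : (l * M * c * q.-1 = l * (q ^ m).-1 * c)%N.
      by rewrite ME [(q.-1 * M)%N]mulnC mulnA mulnAC.
    rewrite -exprM e [X in _ * X]exprM [g ^+ (l * _.-1)]exprM.
    by rewrite (prim_expr_order glp) expr1n mulr1.
  have x0 : g ^+ (l * M * c) != 0 by rewrite expf_neq0 // (prim_root_neq0 g_prim).
  have xF : g ^+ (l * M * c) \in Fq by rewrite yE Fq_ik codom_f.
  have F0 : 0 \in Fq by rewrite Fq_ik -(rmorph0 ik) codom_f.
  by have := Fq_clique _ _ xF F0 x0; rewrite /peisert_graph /cayley subr0.
have DK : (D %| #|K|.-1)%N by rewrite card_K ME dvdn_mull.
have KN : (#|K|.-1 = D * (#|K|.-1 %/ D))%N by rewrite mulnC divnK.
have vK_gen c : (0 < c < m)%N -> vK ^+ (#|kk| ^ c) != vK.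
  move=> cm; rewrite -(inj_eq (fmorph_inj iK)) rmorphXn -vE card_k.
  exact: v_gen.
have cardK' : #|K| = (#|kk| ^ m)%N by rewrite card_k.
have DM' : (D %| \sum_(c < m) #|kk| ^ c)%N by rewrite card_k.
have := katz_bound i (@complex_arch R) cardK' vK_gen D1 DM' KN hp zp.
set N := (#|K|.-1 %/ D)%N.
(* The character of [K] sends [h], that is [g ^+ l], to [w ^+ l]; it thus restricts the one sending
   [g] to [w], whose exponents are below [d./2] on the connection set. *)
have val_chi a : exists e, (e < d./2)%N /\
    powchar N D (w ^+ l) (h ^+ N) (vK + i a) = w ^+ e.
  have va : v + ik a \in peisert_set g d.
    have := v_peisert (ik (- a)); rewrite rmorphN opprK; apply.
    by rewrite -rmorphN Fq_ik codom_f.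
  have vKa : iK (vK + i a) = v + ik a by rewrite rmorphD /= -vE iE.
  have vKa0 : vK + i a != 0.
    by rewrite -(fmorph_eq0 iK) vKa; apply: contraTneq va => ->; apply: peisert_set0.
  have [c vc] := prim_root_gen hp vKa0; exists (l * c %% d)%N.
  split; last by rewrite vc powchar_gen // (prim_expr_mod wp) exprM.
  by apply: (peisert_set_exp g_prim d1 dF); rewrite exprM hE -rmorphXn -vc vKa.
have [e eP] := choice val_chi.
rewrite (eq_bigr _ (fun a _ => (eP a).2)) => kb.
have := half_circle_sum R d_ge4 d_even (fun a => (eP a).1).
have kb2 : `|\sum_a w ^+ e a| ^+ 2 <= ((m - 1)%:R * sqrtC #|kk|%:R) ^+ 2.
  by rewrite lerXn2r ?nnegrE // (le_trans _ kb).
move/le_trans/(_ kb2); rewrite [X in _ <= X]exprMn sqrtCK -natrX -natrM.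
rewrite -(rmorph_nat (real_complex R)) lecR card_k => {kb kb2}.
rewrite natrM natrX natrB // exprMn.
set s := sin _; have s_low : pi / d%:R * ((d%:R - 1) / d%:R) <= s := sin_pi_div R d_ge4.
have mnR : m%:R <= n%:R :> R by rewrite ler_nat dvdn_leq.
have m1R : 1 <= m%:R :> R by rewrite ler1n.
have qR : 0 < q%:R :> R by rewrite ltr0n ltnW.
have dR : 4 <= d%:R :> R by rewrite ler_nat.
have p0 := pi_gt0 R.
(* One factor [q] cancels in [q ^ 2 s ^ 2 <= (m - 1) ^ 2 q]. *)
rewrite expr2 -mulrA [X in _ <= X]mulrC ler_pM2l // => qs.
have sg : 0 <= pi / d%:R * ((d%:R - 1) / d%:R) :> R.
  by rewrite !mulr_ge0 ?invr_ge0 //; lra.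
have s2 : (pi / d%:R * ((d%:R - 1) / d%:R)) ^+ 2 <= s ^+ 2.
  by rewrite lerXn2r ?nnegrE // (le_trans sg).
have mn2 : (m%:R - 1) ^+ 2 <= (n%:R - 1) ^+ 2 :> R.
  by rewrite lerXn2r ?nnegrE //; lra.
move: q_large; rewrite ltr_pdivrMr; last by rewrite mulr_gt0 ?exprn_gt0 //; lra.
apply/negP; rewrite -leNgt.
have -> : pi ^+ 2 * (d%:R - 1) ^+ 2 =
    (pi / d%:R * ((d%:R - 1) / d%:R)) ^+ 2 * d%:R ^+ 4 :> R.
  move: (d%:R : R) dR => x dR; field.
  by rewrite gt_eqF //; lra.
rewrite mulrA ler_wpM2r ?exprn_ge0 // (le_trans _ (le_trans qs mn2)) //.
by rewrite ler_wpM2l // ltW.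
Qed.
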